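(* Let $M$ be the module of a minimal higher matrix factorization with respect to a regular sequence $f_1,\dots,f_c$ in a regular local ring $S$ with residue field $k$, and let $R=S/(f_1,\dots,f_c)$. Then the $\mathcal R$-module $\operatorname{Ext}_R^{\mathrm{even}}(M,k)$ has an $\mathcal R$-free presentation as the cokernel of the map $$\tau:\operatorname{Ext}_S^1(M,k)\otimes_k\mathcal R(-1)\to\operatorname{Hom}(M,k)\otimes_k\mathcal R$$ whose linear part $$\mu^\vee:\operatorname{Ext}_S^1(M,k)\to\operatorname{Hom}(M,k)\otimes_k\mathcal R_1$$ is the vector space dual of the multiplication map $$\mu:E_1\otimes_k\operatorname{Tor}_0^S(M,k)\to\operatorname{Tor}_1^S(M,k).$$
   Context: Setting. $S$ is a regular local ring with maximal ideal $\mathfrak m$ and residue field $k$; all modules are finitely generated. $f_1,\dots,f_c\in\mathfrak m$ is a regular sequence, $I=(f_1,\dots,f_c)$, $R=S/I$. A map of free modules is minimal if its image lies in $\mathfrak m$ times the target. One identifies $\operatorname{Ext}_S^i(M,k)=\operatorname{Hom}_k(\operatorname{Tor}_i^S(M,k),k)$. Higher matrix factorizations (Eisenbud–Peeva). A higher matrix factorization $(d,h)$ with respect to $f_1,\dots,f_c$ consists of: finitely generated free $S$-modules $A_0,A_1$ with filtrations $0=A_s(0)\subseteq A_s(1)\subseteq\dots\subseteq A_s(c)=A_s$ ($s=0,1$) such that each $A_s(p-1)$ is a free direct summand of $A_s(p)$; and maps $\bigoplus_{q=1}^cA_0(q)\xrightarrow{h}A_1\xrightarrow{d}A_0$ preserving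 filtrations (the left module being filtered by $\bigoplus_{q\le p}A_0(q)$) such that the induced maps $A_0(p)\xrightarrow{h_p}A_1(p)\xrightarrow{d_p}A_0(p)$ satisfy, for all $p$: (a) $d_ph_p\equiv f_p\,\mathrm{Id}_{A_0(p)}$ mod $(f_1,\dots,f_{p-1})A_0(p)$; (b) $\pi_ph_pd_p\equiv f_p\pi_p$ mod $(f_1,\dots,f_{p-1})B_1(p)$, where $\pi_p:A_1(p)\to B_1(p):=A_1(p)/A_1(p-1)$ is the projection. It is minimal if $d$ and $h$ are minimal. Its module is $M=\operatorname{coker}(R\otimes_S d)$. Exterior algebra. $E=\bigwedge_k(I/\mathfrak mI)=k\langle e_1,\dots,e_c\rangle$ with $e_i$ the class of $f_i$, of degree 1. If $(\mathbf F,\partial)$ is an $S$-free resolution of $M$ and $\sigma_i$ is a homotopy for $f_i$ on $\mathbf F$ ($\partial\sigma_i+\sigma_i\partial=f_i$), then $e_i$ acts on $\operatorname{Tor}^S(M,k)=H(\mathbf F\otimes k)$ by the map induced by $\sigma_i\otimes1$; this is a well-defined graded $E$-module structure. CI operators. $\mathcal R=\operatorname{Sym}_k((I/\mathfrak mI)^\vee)=k[\chi_1,\dots,\chi_c]$, with $\chi_1,\dots,\chi_c$ the basis of $\mathcal R_1=\operatorname{Hom}_k(E_1,k)$ dual to $e_1,\dots,e_c$. If $(\mathbf F,\partial)$ is an $R$-free resolution of $M$ and $(\widetilde{\mathbf F},\widetilde\partial)$ is a lift to a sequence of maps of free $S$-modules, write $\widetilde\partial^2=\sum_if_i\widetilde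 t_i$; the maps $t_i=R\otimes\widetilde t_i$ are chain maps of degree $-2$, and $\chi_i$ acts on $\operatorname{Ext}_R(M,k)=H(\operatorname{Hom}(\mathbf F,k))$, raising cohomological degree by 2, as the map induced by $t_i$. $\operatorname{Ext}_R^{\mathrm{even}}(M,k)=\bigoplus_j\operatorname{Ext}_R^{2j}(M,k)$. In $\mathcal R(-1)$ and ''linear part'', the $\chi_i$ are counted with degree 1. *)

(* Defs.v *)
From HB Require Import structures.
From mathcomp Require Import all_boot all_order all_algebra.
From mathcomp Require Import boolp.
From mathcomp.multinomials Require Import ssrcomplements mpoly.

Set Implicit Arguments.
Unset Strict Implicit.
Unset Printing Implicit Defensive.

Import GRing.Theory.
Local Open Scope ring_scope.

Section CommutativeAlgebra.
Variable S : comUnitRingType.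
Implicit Types (J P : S -> Prop) (s t : S).

Definition is_ideal J : Prop :=
  [/\ J 0, forall s t, J s -> J t -> J (s + t) & forall s t, J t -> J (s * t)].

Definition is_prime_ideal P : Prop :=
  [/\ is_ideal P, ~ P 1 & forall s t, P (s * t) -> P s \/ P t].

Definition generates n (g : 'I_n -> S) J : Prop :=
  forall s, J s <-> exists a : 'I_n -> S, s = \sum_i a i * g i.

Definition noetherian : Prop :=
  forall J, is_ideal J -> exists n (g : 'I_n -> S), generates g J.

Definition prime_chain (n : nat) : Prop :=
  exists P : nat -> S -> Prop,
    (forall i, (i <= n)%N -> is_prime_ideal (P i)) /\
    (forall i, (i < n)%N ->
       (forall s, P i s -> P i.+1 s) /\ (exists s, P i.+1 s /\ ~ P i s)).

Definition krull_dim (n : nat) : Prop := prime_chain n /\ ~ prime_chain n.+1.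

(* The residue field is presented as a surjection res : S -> k; its kernel is
   the maximal ideal. *)
Definition local_with_residue (k : fieldType) (res : {rmorphism S -> k}) : Prop :=
  (forall x, exists s, res s = x) /\
  (forall s, s \is a GRing.unit <-> res s <> 0).

Definition regular_local (k : fieldType) (res : {rmorphism S -> k}) : Prop :=
  [/\ noetherian, local_with_residue res &
      exists d (g : 'I_d -> S),
        krull_dim d /\ generates g (fun s => res s = 0)].

(* The sequence f_1, ..., f_c is indexed by 'I_c, so that f_p is f i for
   p = i + 1; span_lt f p is the ideal (f_1, ..., f_p). *)
Definition span_lt c (f : 'I_c -> S) (p : nat) (s : S) : Prop :=
  exists a : 'I_c -> S, s = \sum_(i < c | (i < p)%N) a i * f i.

(* The condition (f_1, ..., f_c) <> S is left out: below the f_i are always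
   assumed to lie in the maximal ideal. *)
Definition regular_seq c (f : 'I_c -> S) : Prop :=
  forall (p : 'I_c) s, span_lt f p (f p * s) -> span_lt f p s.

End CommutativeAlgebra.

(* S is a regular local ring with residue field k, f_1, ..., f_c is a regular
   sequence in the maximal ideal and R = S / (f_1, ..., f_c).  The quotient R
   is presented by a surjection quo : S -> R with kernel (f_1, ..., f_c), and
   resR : R -> k is the induced residue map. *)
Record ci_setting (S : comUnitRingType) (k : fieldType) (R : comNzRingType)
    (c : nat) := CiSetting {
  res : {rmorphism S -> k};
  quo : {rmorphism S -> R};
  resR : {rmorphism R -> k};
  fseq : 'I_c -> S;
  ci_regular_local : regular_local res;
  ci_fseq_max : forall i, res (fseq i) = 0;
  ci_fseq_regular : regular_seq fseq;
  ci_quo_surj : forall r, exists s, quo s = r;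
  ci_quo_ker : forall s, quo s = 0 <-> span_lt fseq c s;
  ci_resR_quo : forall s, resR (quo s) = res s
}.

Section FreeModules.
Variable S : comUnitRingType.

(* Submodules of the free module S^n, as predicates on row vectors. *)
Definition is_submod n (U : 'rV[S]_n -> Prop) : Prop :=
  [/\ U 0, forall x y, U x -> U y -> U (x + y) &
      forall s x, U x -> U (s *: x)].

Definition fg_free n (U : 'rV[S]_n -> Prop) : Prop :=
  exists r (b : 'M[S]_(r, n)),
    (forall x, U x <-> exists a : 'rV_r, x = a *m b) /\
    (forall a a' : 'rV_r, a *m b = a' *m b -> a = a').

Definition direct_summand n (U U' : 'rV[S]_n -> Prop) : Prop :=
  exists C : 'rV[S]_n -> Prop,
    [/\ is_submod C,
        forall x, U' x <-> exists y z, [/\ U y, C z & x = y + z] &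
        forall x, U x -> C x -> x = 0].

Definition hmf_filtration c n (A : nat -> 'rV[S]_n -> Prop) : Prop :=
  [/\ forall x, A 0%N x <-> x = 0,
      forall x, A c x,
      forall p, (p <= c)%N -> is_submod (A p) &
      forall p, (p < c)%N -> fg_free (A p) /\ direct_summand (A p) (A p.+1)].

(* Membership in the submodule (f_1, ..., f_p) U. *)
Definition span_mul c (f : 'I_c -> S) (p : nat) n (U : 'rV[S]_n -> Prop)
    (x : 'rV[S]_n) : Prop :=
  exists u : 'I_c -> 'rV[S]_n,
    (forall i, U (u i)) /\ x = \sum_(i < c | (i < p)%N) f i *: u i.

End FreeModules.

Section HMF.
Variables (S : comUnitRingType) (k : fieldType) (R : comNzRingType) (c : nat).
Variable X : ci_setting S k R c.
Notation f := (fseq X).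

(* Matrices act on row vectors on the right: d : S^n1 -> S^n0 is x |-> x *m d.
   A map h from the direct sum of the A_0(q) to A_1 is given by its components
   h_q on A_0(q).  As A_0(q) is a direct summand of A_0 = S^n0, h_q is the
   restriction of a matrix on A_0; only that restriction is ever used.
   For p : 'I_c, the stage A_s(p) of the usual indexing (from 1) is A_s p.+1. *)
Record hmf := Hmf {
  hmf_n0 : nat;
  hmf_n1 : nat;
  hmf_A0 : nat -> 'rV[S]_hmf_n0 -> Prop;
  hmf_A1 : nat -> 'rV[S]_hmf_n1 -> Prop;
  hmf_d : 'M[S]_(hmf_n1, hmf_n0);
  hmf_h : 'I_c -> 'M[S]_(hmf_n0, hmf_n1);
  hmf_filt0 : hmf_filtration c hmf_A0;
  hmf_filt1 : hmf_filtration c hmf_A1;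
  hmf_d_filt : forall p x, (p <= c)%N -> hmf_A1 p x -> hmf_A0 p (x *m hmf_d);
  hmf_h_filt : forall p (q : 'I_c) x, (p <= c)%N -> (q.+1 <= p)%N ->
    hmf_A0 q.+1 x -> hmf_A1 p (x *m hmf_h q);
  hmf_dh : forall (p : 'I_c) x, hmf_A0 p.+1 x ->
    span_mul f p (hmf_A0 p.+1) (x *m hmf_h p *m hmf_d - f p *: x);
  (* The congruence holds in B_1(p) = A_1(p) / A_1(p-1). *)
  hmf_hd : forall (p : 'I_c) x, hmf_A1 p.+1 x ->
    exists y z, [/\ hmf_A1 p y, span_mul f p (hmf_A1 p.+1) z &
                    x *m hmf_d *m hmf_h p - f p *: x = y + z]
}.

Definition hmf_minimal (H : hmf) : Prop :=
  (forall x : 'rV_(hmf_n1 H), map_mx (res X) (x *m hmf_d H) = 0) /\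
  (forall (q : 'I_c) x, hmf_A0 q.+1 x -> map_mx (res X) (x *m hmf_h H q) = 0).

End HMF.

(* q presents M as the cokernel of D : R^m -> R^n. *)
Definition is_coker (R : comNzRingType) m n (D : 'M[R]_(m, n)) (M : lmodType R)
    (q : {linear 'rV[R]_n -> M}) : Prop :=
  (forall z, exists x, q x = z) /\
  (forall x, q x = 0 <-> exists y : 'rV_m, x = y *m D).

(* A resolution by finitely generated free T-modules of the R-module M, viewed
   as a T-module along phi. *)
Record free_resolution (T R : comNzRingType) (phi : {rmorphism T -> R})
    (M : lmodType R) := FreeResolution {
  rk : nat -> nat;
  dif : forall i, 'M[T]_(rk i.+1, rk i);
  aug : {linear 'rV[T]_(rk 0) -> M | phi \; *:%R};
  aug_surj : forall z, exists x, aug x = z;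
  aug_exact : forall x, aug x = 0 <-> exists y : 'rV_(rk 1), x = y *m dif 0;
  dif_exact : forall i (x : 'rV_(rk i.+1)),
    x *m dif i = 0 <-> exists y : 'rV_(rk i.+2), x = y *m dif i.+1
}.

(* For subspaces B <= Z of V, the quotient Z / B is represented by the
   library's complement of B in Z; cls is the quotient map (it is meaningful on
   Z) and rep picks representatives. *)
Section SubQuotient.
Variables (k : fieldType) (V : vectType k) (Z B : {vspace V}).

Definition sq := subvs_of (Z :\: B)%VS.
HB.instance Definition _ := Vector.on sq.

Definition cls (z : V) : sq := vsproj (Z :\: B) (addv_pi1 Z B z).
Definition rep (x : sq) : V := vsval x.

Fact cls_is_linear : linear cls.
Proof. by move=> a u v; rewrite /cls !linearP. Qed.
HB.instance Definition _ := GRing.isLinear.Build k V sq *:%R cls cls_is_linear.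

Fact rep_is_linear : linear rep.
Proof. by move=> a u v; rewrite /rep linearP. Qed.
HB.instance Definition _ := GRing.isLinear.Build k sq V *:%R rep rep_is_linear.

Lemma rep_mem x : rep x \in Z.
Proof. by apply: subvP (diffvSl Z B) _ _; apply: subvsP. Qed.

Lemma repK x : cls (rep x) = x.
Proof.
rewrite /cls /rep /addv_pi1 daddv_pi_id ?subvsP ?capv_diff //.
exact: vsvalK.
Qed.

Lemma clsP z : z \in Z -> z - rep (cls z) \in B.
Proof.
move=> Zz; rewrite /rep /cls vsprojK ?memv_pi //.
have Hz : z \in (Z + B)%VS by apply: subvP (addvSl Z B) _ Zz.
by rewrite -{1}(addv_pi1_pi2 Hz) addrC addKr memv_pi.
Qed.

Lemma cls_eq0 z : z \in Z -> cls z = 0 <-> z \in B.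
Proof.
move=> Zz; split=> [z0 | Bz]; first by have := clsP Zz; rewrite z0 (linear0 rep) subr0.
have : rep (cls z) \in ((Z :\: B) :&: B)%VS.
  rewrite memv_cap subvsP /=; have := rpredB Bz (clsP Zz).
  by rewrite opprB addrCA subrr addr0.
by rewrite capv_diff memv0 => /eqP /(congr1 cls); rewrite repK linear0.
Qed.

End SubQuotient.

(* This is the map induced by g as soon as g Z <= Z' and g B <= B'; see
   sq_map_cls. *)
Definition sq_map (k : fieldType) (V V' : vectType k) (Z B : {vspace V})
    (Z' B' : {vspace V'}) (g : {linear V -> V'}) : sq Z B -> sq Z' B' :=
  fun x => cls Z' B' (g (rep x)).

Fact sq_map_is_linear (k : fieldType) (V V' : vectType k) (Z B : {vspace V})
    (Z' B' : {vspace V'}) (g : {linear V -> V'}) :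
  linear (@sq_map k V V' Z B Z' B' g).
Proof. by move=> a u v; rewrite /sq_map !linearP. Qed.
HB.instance Definition _ (k : fieldType) (V V' : vectType k) (Z B : {vspace V})
    (Z' B' : {vspace V'}) (g : {linear V -> V'}) :=
  GRing.isLinear.Build k _ _ *:%R (@sq_map k V V' Z B Z' B' g)
    (@sq_map_is_linear k V V' Z B Z' B' g).

Lemma sq_map_cls (k : fieldType) (V V' : vectType k) (Z B : {vspace V})
    (Z' B' : {vspace V'}) (g : {linear V -> V'}) :
    (forall z, z \in Z -> g z \in Z') -> (forall z, z \in B -> g z \in B') ->
  forall z, z \in Z -> sq_map Z' B' g (cls Z B z) = cls Z' B' (g z).
Proof.
move=> gZ gB z Zz; apply/eqP; rewrite -subr_eq0 /sq_map -linearB -linearB.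
apply/eqP/cls_eq0; first by rewrite gZ // rpredB // rep_mem.
by rewrite -opprB linearN rpredN gB // clsP.
Qed.

Section Tor.
Variables (S : comUnitRingType) (k : fieldType) (R : comNzRingType) (c : nat).
Variables (X : ci_setting S k R c) (M : lmodType R).
Variable G : free_resolution (quo X) M.

Definition tor_dif i : 'M[k]_(rk G i.+1, rk G i) := map_mx (res X) (dif G i).

Definition tor_cycles i : {vspace 'rV[k]_(rk G i)} :=
  match i with
  | 0 => fullv
  | i'.+1 => lker (linfun (mulmxr (tor_dif i')))
  end.

Definition tor_bounds i : {vspace 'rV[k]_(rk G i)} :=
  limg (linfun (mulmxr (tor_dif i))).

Definition tor i : vectType k := sq (tor_cycles i) (tor_bounds i).

Definition tor_cls i (z : 'rV[k]_(rk G i)) : tor i :=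
  cls (tor_cycles i) (tor_bounds i) z.

(* Ext_S^i(M, k) = Hom_k(Tor_i^S(M, k), k); for i = 0 this is Hom(M, k). *)
Definition extS i : vectType k := 'Hom(tor i, k^o).

Definition is_homotopy (s : S) (sg : forall i, 'M[S]_(rk G i, rk G i.+1)) : Prop :=
  sg 0%N *m dif G 0 = s%:M /\
  (forall i, dif G i *m sg i + sg i.+1 *m dif G i.+1 = s%:M).

Record homotopies := Homotopies {
  htp : 'I_c -> forall i, 'M[S]_(rk G i, rk G i.+1);
  htpP : forall j, is_homotopy (fseq X j) (htp j)
}.

Variable sg : homotopies.

Definition tor_e (j : 'I_c) i : tor i -> tor i.+1 :=
  sq_map (tor_cycles i.+1) (tor_bounds i.+1) (mulmxr (map_mx (res X) (htp sg j i))).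
HB.instance Definition _ j i := GRing.Linear.on (@tor_e j i).

(* mu : E_1 (x) Tor_0 -> Tor_1 restricted to e_j (x) Tor_0. *)
Definition mu (j : 'I_c) : 'Hom(tor 0, tor 1) := linfun (@tor_e j 0).

End Tor.

Arguments tor_cls {S k R c X M} G i z.

Section Ext.
Variables (S : comUnitRingType) (k : fieldType) (R : comNzRingType) (c : nat).
Variables (X : ci_setting S k R c) (M : lmodType R).
Variable F : free_resolution (idfun : {rmorphism R -> R}) M.

(* A map phi : R^n -> k is encoded by the column of its values on the standard
   basis, so that precomposition with x |-> x *m A is left multiplication by
   the reduction of A. *)
Definition ext_dif i : 'M[k]_(rk F i.+1, rk F i) := map_mx (resR X) (dif F i).

Definition ext_cocycles i : {vspace 'cV[k]_(rk F i)} :=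
  lker (linfun (mulmx (ext_dif i))).

Definition ext_cobounds i : {vspace 'cV[k]_(rk F i)} :=
  match i with
  | 0 => 0%VS
  | i'.+1 => limg (linfun (mulmx (ext_dif i')))
  end.

Definition extR i : vectType k := sq (ext_cocycles i) (ext_cobounds i).

Definition ext_cls i (z : 'cV[k]_(rk F i)) : extR i :=
  cls (ext_cocycles i) (ext_cobounds i) z.

Record ci_lift := CiLift {
  lift_dif : forall i, 'M[S]_(rk F i.+1, rk F i);
  lift_t : 'I_c -> forall i, 'M[S]_(rk F i.+2, rk F i);
  lift_difP : forall i, map_mx (quo X) (lift_dif i) = dif F i;
  lift_tP : forall i,
    lift_dif i.+1 *m lift_dif i = \sum_j fseq X j *: lift_t j i
}.

Variable L : ci_lift.

(* t_j = R (x) t~_j *)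
Definition ci_t (j : 'I_c) i : 'M[R]_(rk F i.+2, rk F i) :=
  map_mx (quo X) (lift_t L j i).

Definition ext_chi (j : 'I_c) i : extR i -> extR i.+2 :=
  sq_map (ext_cocycles i.+2) (ext_cobounds i.+2)
    (mulmx (map_mx (resR X) (ci_t j i))).
HB.instance Definition _ j i := GRing.Linear.on (@ext_chi j i).

End Ext.

Arguments ext_cls {S k R c} X {M} F i z.

Section Koszul.
Variable S : comUnitRingType.

Lemma regular_seq_syzygy c (f : 'I_c -> S) (a : 'I_c -> S) (n : nat) :
    regular_seq f -> (n <= c)%N -> \sum_(i < c | (i < n)%N) a i * f i = 0 ->
  forall i : 'I_c, (i < n)%N -> span_lt f c (a i).
Proof.
move=> freg; elim: n a => [|n IHn] a le_nc s0 i; first by rewrite ltn0.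
pose p := Ordinal le_nc.
have split_sum b : \sum_(i < c | (i < n.+1)%N) b i * f i =
    b p * f p + \sum_(i < c | (i < n)%N) b i * f i :> S.
  rewrite (bigD1 p) //=; congr (_ + _); apply: eq_bigl => j.
  by rewrite ltnS ltn_neqAle andbC -val_eqE.
have [b def_ap] : span_lt f p (a p).
  apply: freg; exists (fun i => - a i).
  move/eqP: s0; rewrite split_sum addr_eq0 mulrC => /eqP ->.
  by rewrite -sumrN; apply: eq_bigr => j _; rewrite mulNr.
have Iap : span_lt f c (a p).
  exists (fun i : 'I_c => if (i < n)%N then b i else 0); rewrite def_ap.
  rewrite [LHS]big_mkcond [RHS]big_mkcond; apply: eq_bigr => j _ /=.
  by rewrite ltn_ord; case: ifP; rewrite ?mul0r.
rewrite ltnS leq_eqVlt => /predU1P[i_n | lt_in].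
  by have -> : i = p by apply: val_inj.
have s0' : \sum_(i < c | (i < n)%N) (a i + b i * f p) * f i = 0.
  rewrite -[RHS]s0 split_sum def_ap mulr_suml addrC -big_split /=.
  by apply: eq_bigr => j _; rewrite mulrDl mulrAC.
have [e def_e] := IHn _ (ltnW le_nc) s0' i lt_in.
exists (fun j => e j - (if j == p then b i else 0)).
have -> : a i = (a i + b i * f p) - b i * f p by rewrite addrK.
rewrite def_e; under [RHS]eq_bigr do rewrite mulrBl.
rewrite sumrB; congr (_ - _); rewrite (bigD1 p) ?ltn_ord //= eqxx big1 ?addr0 //.
by move=> j /andP[_ /negPf->]; rewrite mul0r.
Qed.

End Koszul.

Section Commutation.
Variables (S : comUnitRingType) (k : fieldType) (R : comNzRingType) (c : nat).
Variables (X : ci_setting S k R c).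
Notation f := (fseq X).
Notation "A ^r" := (map_mx (res X) A) (at level 2, format "A ^r").

Lemma res_quo0 s : quo X s = 0 -> res X s = 0.
Proof. by move=> s0; rewrite -ci_resR_quo s0 rmorph0. Qed.

Lemma map_res m n (A : 'M[S]_(m, n)) :
  map_mx (resR X) (map_mx (quo X) A) = A^r.
Proof. by apply/matrixP=> i j; rewrite !mxE ci_resR_quo. Qed.

Lemma mx_syzygy m n (A : 'I_c -> 'M[S]_(m, n)) :
  \sum_i f i *: A i = 0 -> forall i, map_mx (quo X) (A i) = 0.
Proof.
move=> sA0 i; apply/matrixP=> x y; rewrite !mxE; apply/ci_quo_ker.
apply: (@regular_seq_syzygy _ _ _ (fun i => A i x y) c) => //.
  exact: ci_fseq_regular.
have := congr1 (fun B : 'M_(m, n) => B x y) sA0; rewrite summxE mxE => s0.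
by rewrite -[RHS]s0; apply: eq_big => j; rewrite ?ltn_ord // mxE mulrC.
Qed.

Lemma mx_span m n (A : 'M[S]_(m, n)) :
  map_mx (quo X) A = 0 -> exists u : 'I_c -> 'M[S]_(m, n), A = \sum_i f i *: u i.
Proof.
move=> A0.
have /fin_all_exists[a def_a] (xy : 'I_m * 'I_n) :
    exists a : 'I_c -> S, A xy.1 xy.2 = \sum_i a i * f i.
  have /ci_quo_ker[a ->] : quo X (A xy.1 xy.2) = 0.
    by have := congr1 (fun B : 'M_(m, n) => B xy.1 xy.2) A0; rewrite !mxE.
  by exists a; apply: eq_bigl => j; rewrite ltn_ord.
exists (fun i => \matrix_(x, y) a (x, y) i).
apply/matrixP=> x y; rewrite (def_a (x, y)) summxE.
by apply: eq_bigr => i _; rewrite !mxE mulrC.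
Qed.

Variables (M : lmodType R) (F : free_resolution (idfun : {rmorphism R -> R}) M).
Variable L : ci_lift X F.
Notation dt := (lift_dif L).
Notation t := (lift_t L).

Lemma ext_difE i : ext_dif X F i = (dt i)^r.
Proof. by rewrite /ext_dif -(lift_difP L) map_res. Qed.

Lemma ci_chain j i :
  map_mx (quo X) (dt i.+2 *m t j i - t j i.+1 *m dt i) = 0.
Proof.
move: j; apply: mx_syzygy; under eq_bigr do rewrite scalerBr.
rewrite sumrB; apply/eqP; rewrite subr_eq0; apply/eqP.
transitivity (dt i.+2 *m (dt i.+1 *m dt i)).
  by rewrite lift_tP mulmx_sumr; apply: eq_bigr => j _; rewrite -scalemxAr.
rewrite mulmxA lift_tP mulmx_suml.
by apply: eq_bigr => j _; rewrite -scalemxAl.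
Qed.

Lemma ci_chain_res j i : (dt i.+2)^r *m (t j i)^r = (t j i.+1)^r *m (dt i)^r.
Proof.
have := ci_chain j i; move/(congr1 (map_mx (resR X))); rewrite map_res map_mx0.
by rewrite map_mxB !map_mxM => /eqP; rewrite subr_eq0 => /eqP.
Qed.

Lemma mem_cocycles i z :
  (z \in ext_cocycles X F i) = ((dt i)^r *m z == 0).
Proof. by rewrite memv_ker lfunE /= ext_difE. Qed.

Lemma mem_cobounds i y : (dt i)^r *m y \in ext_cobounds X F i.+1.
Proof. by rewrite /= -ext_difE; have := memv_img (linfun (mulmx (ext_dif X F i))) (memvf y); rewrite lfunE. Qed.

Lemma chi_cocycles j i z :
  z \in ext_cocycles X F i -> (t j i)^r *m z \in ext_cocycles X F i.+2.
Proof.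
rewrite !mem_cocycles mulmxA ci_chain_res -mulmxA => /eqP ->.
by rewrite mulmx0.
Qed.

Lemma chi_cobounds j i z :
  z \in ext_cobounds X F i -> (t j i)^r *m z \in ext_cobounds X F i.+2.
Proof.
case: i z => [|i] z; first by rewrite memv0 => /eqP ->; rewrite mulmx0 mem0v.
case/memv_imgP=> y _ ->; rewrite lfunE /= ext_difE mulmxA -ci_chain_res -mulmxA.
exact: mem_cobounds.
Qed.

Lemma ext_chi_cls j i z : z \in ext_cocycles X F i ->
  ext_chi L j (ext_cls X F i z) = ext_cls X F i.+2 ((t j i)^r *m z).
Proof.
move=> Zz; rewrite /ext_chi /ext_cls sq_map_cls //= ?map_res //.
- by move=> y; apply: chi_cocycles.
- by move=> y; apply: chi_cobounds.
Qed.

Lemma ext_chiC j l i (x : extR X F i) :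
  ext_chi L l (ext_chi L j x) = ext_chi L j (ext_chi L l x).
Proof.
have Zx := rep_mem x; rewrite -[x]repK -/(ext_cls X F i (rep x)).
rewrite !ext_chi_cls ?chi_cocycles //.
apply/eqP; rewrite -subr_eq0 /ext_cls -linearB.
apply/eqP/cls_eq0; first by rewrite rpredB ?chi_cocycles.
have [u def_u] := mx_span (ci_chain j i).
have [v def_v] := mx_span (ci_chain j i.+1).
have com : map_mx (quo X) (t l i.+2 *m t j i - t j i.+2 *m t l i -
    (v l *m dt i + dt i.+3 *m u l)) = 0.
  move: l; apply: mx_syzygy.
  under eq_bigr do rewrite scalerBr scalerBr scalerDr.
  rewrite sumrB sumrB big_split /=.
  have -> : \sum_l f l *: (t l i.+2 *m t j i) = dt i.+3 *m dt i.+2 *m t j i.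
    by rewrite lift_tP mulmx_suml; apply: eq_bigr => l _; rewrite -scalemxAl.
  have -> : \sum_l f l *: (t j i.+2 *m t l i) = t j i.+2 *m (dt i.+1 *m dt i).
    by rewrite lift_tP mulmx_sumr; apply: eq_bigr => l _; rewrite -scalemxAr.
  have -> : \sum_l f l *: (v l *m dt i) =
      (dt i.+3 *m t j i.+1 - t j i.+2 *m dt i.+1) *m dt i.
    by rewrite def_v mulmx_suml; apply: eq_bigr => l _; rewrite -scalemxAl.
  have -> : \sum_l f l *: (dt i.+3 *m u l) =
      dt i.+3 *m (dt i.+2 *m t j i - t j i.+1 *m dt i).
    by rewrite def_u mulmx_sumr; apply: eq_bigr => l _; rewrite -scalemxAr.
  rewrite mulmxBl mulmxBr !mulmxA [X in _ - _ - X]addrC.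
  by rewrite addrA subrK subrr.
have {}com : (t l i.+2)^r *m (t j i)^r - (t j i.+2)^r *m (t l i)^r =
    (v l)^r *m (dt i)^r + (dt i.+3)^r *m (u l)^r.
  move/(congr1 (map_mx (resR X))): com; rewrite map_res map_mx0.
  by rewrite !(map_mxB, map_mxD, map_mxM) => /eqP; rewrite subr_eq0 => /eqP.
rewrite !mulmxA -mulmxBl com mulmxDl -!mulmxA.
move: Zx; rewrite mem_cocycles => /eqP ->.
by rewrite mulmx0 add0r mem_cobounds.
Qed.

End Commutation.

(* Graded modules over k[chi_1, ..., chi_c], the chi_i having degree 1. *)
Record grmod (k : fieldType) (c : nat) := GrMod {
  gr_deg : nat -> lmodType k;
  gr_chi : 'I_c -> forall j, {linear gr_deg j -> gr_deg j.+1};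
  gr_chiC : forall i l j (x : gr_deg j),
    gr_chi l j.+1 (gr_chi i j x) = gr_chi i j.+1 (gr_chi l j x)
}.

Section DirectSum.
Variables (k : fieldType) (c : nat) (N : grmod k c).

Record gr_sum := GrSum {
  gr_comp : forall j, gr_deg N j;
  gr_fin : exists n, forall j, (n <= j)%N -> gr_comp j = 0
}.

Lemma gr_sumP (x y : gr_sum) : (forall j, gr_comp x j = gr_comp y j) -> x = y.
Proof.
case: x y => [x Fx] [y Fy] /= xyE.
have xy := functional_extensionality_dep xyE.
by case: y / xy {xyE} Fy => Fy; congr GrSum; apply: Prop_irrelevance.
Qed.

HB.instance Definition _ := gen_eqMixin gr_sum.
HB.instance Definition _ := gen_choiceMixin gr_sum.

Fact gr_fin0 : exists n, forall j, (n <= j)%N -> (0 : gr_deg N j) = 0.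
Proof. by exists 0%N. Qed.
Definition gr_zero := GrSum gr_fin0.

Fact gr_finN (x : gr_sum) :
  exists n, forall j, (n <= j)%N -> - gr_comp x j = 0.
Proof. by have [n xP] := gr_fin x; exists n => j /xP->; rewrite oppr0. Qed.
Definition gr_opp x := GrSum (gr_finN x).

Fact gr_finD (x y : gr_sum) :
  exists n, forall j, (n <= j)%N -> gr_comp x j + gr_comp y j = 0.
Proof.
have [[n xP] [m yP]] := (gr_fin x, gr_fin y); exists (maxn n m) => j.
by rewrite geq_max => /andP[/xP-> /yP->]; rewrite addr0.
Qed.
Definition gr_add x y := GrSum (gr_finD x y).

Fact gr_addA : associative gr_add.
Proof. by move=> x y z; apply: gr_sumP => j /=; rewrite addrA. Qed.
Fact gr_addC : commutative gr_add.
Proof. by move=> x y; apply: gr_sumP => j /=; rewrite addrC. Qed.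
Fact gr_add0 : left_id gr_zero gr_add.
Proof. by move=> x; apply: gr_sumP => j /=; rewrite add0r. Qed.
Fact gr_addN : left_inverse gr_zero gr_opp gr_add.
Proof. by move=> x; apply: gr_sumP => j /=; rewrite addNr. Qed.
HB.instance Definition _ :=
  GRing.isZmodule.Build gr_sum gr_addA gr_addC gr_add0 gr_addN.

Fact gr_finZ (a : k) (x : gr_sum) :
  exists n, forall j, (n <= j)%N -> a *: gr_comp x j = 0.
Proof. by have [n xP] := gr_fin x; exists n => j /xP->; rewrite scaler0. Qed.
Definition gr_scale a x := GrSum (gr_finZ a x).

Fact gr_scaleA a b x : gr_scale a (gr_scale b x) = gr_scale (a * b) x.
Proof. by apply: gr_sumP => j /=; rewrite scalerA. Qed.
Fact gr_scale1 : left_id 1 gr_scale.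
Proof. by move=> x; apply: gr_sumP => j /=; rewrite scale1r. Qed.
Fact gr_scaleDr : right_distributive gr_scale +%R.
Proof. by move=> a x y; apply: gr_sumP => j /=; rewrite scalerDr. Qed.
Fact gr_scaleDl x : {morph gr_scale^~ x : a b / a + b}.
Proof. by move=> a b; apply: gr_sumP => j /=; rewrite scalerDl. Qed.
HB.instance Definition _ := GRing.Zmodule_isLmodule.Build k gr_sum
  gr_scaleA gr_scale1 gr_scaleDr gr_scaleDl.

Definition gr_shift_comp (i : 'I_c) (x : gr_sum) (j : nat) : gr_deg N j :=
  match j with
  | 0 => 0
  | j'.+1 => gr_chi N i j' (gr_comp x j')
  end.

Fact gr_fin_shift i x :
  exists n, forall j, (n <= j)%N -> gr_shift_comp i x j = 0.
Proof.
have [n xP] := gr_fin x; exists n.+1 => -[|j] //= /xP->; exact: linear0.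
Qed.
Definition gr_shift i x := GrSum (gr_fin_shift i x).

Fact gr_shift_is_linear i : linear (gr_shift i).
Proof.
by move=> a x y; apply: gr_sumP => -[|j] /=; rewrite ?linearP ?scaler0 ?addr0.
Qed.
HB.instance Definition _ i :=
  GRing.isLinear.Build k gr_sum gr_sum *:%R (gr_shift i) (gr_shift_is_linear i).

Lemma gr_shiftC i l x : gr_shift l (gr_shift i x) = gr_shift i (gr_shift l x).
Proof.
by apply: gr_sumP => -[|[|j]] //=; rewrite ?linear0 // gr_chiC.
Qed.

End DirectSum.

Section PolyAction.
Variables (k : fieldType) (c : nat) (L : lmodType k).
Variable op : 'I_c -> {linear L -> L}.
Hypothesis opC : forall i l x, op l (op i x) = op i (op l x).
Implicit Types (m : 'X_{1..c}) (p q : {mpoly k[c]}) (x y : L).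

Definition mon_seq m (s : seq 'I_c) x : L := foldr (fun i => iter (m i) (op i)) x s.
Definition mon_act m x : L := mon_seq m (enum 'I_c) x.
Definition poly_act p x : L := \sum_(m <- msupp p) p@_m *: mon_act m x.

Lemma iter_opP n i a x y :
  iter n (op i) (a *: x + y) = a *: iter n (op i) x + iter n (op i) y.
Proof. by elim: n => //= n ->; rewrite linearP. Qed.

Lemma mon_seqP m s a x y :
  mon_seq m s (a *: x + y) = a *: mon_seq m s x + mon_seq m s y.
Proof. by elim: s => //= i s ->; rewrite iter_opP. Qed.

Lemma mon_actP m a x y : mon_act m (a *: x + y) = a *: mon_act m x + mon_act m y.
Proof. exact: mon_seqP. Qed.

Lemma mon_act0 m : mon_act m 0 = 0.
Proof. by have := mon_actP m (-1) 0 0; rewrite !scaleN1r !addNr. Qed.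

Lemma mon_actZ m a x : mon_act m (a *: x) = a *: mon_act m x.
Proof. by rewrite -[a *: x]addr0 mon_actP mon_act0 addr0. Qed.

Lemma mon_actD m x y : mon_act m (x + y) = mon_act m x + mon_act m y.
Proof. by rewrite -[x in LHS]scale1r mon_actP scale1r. Qed.

Lemma iter_opC n n' i l x :
  iter n (op i) (iter n' (op l) x) = iter n' (op l) (iter n (op i) x).
Proof.
have step y : op i (iter n' (op l) y) = iter n' (op l) (op i y).
  by elim: n' => //= n' <-; rewrite opC.
by elim: n => //= n ->; rewrite step.
Qed.

Lemma iter_mon n i m s x :
  iter n (op i) (mon_seq m s x) = mon_seq m s (iter n (op i) x).
Proof. by elim: s => //= l s <-; rewrite iter_opC. Qed.

Lemma mon_actM m m' x : mon_act (m + m')%MM x = mon_act m (mon_act m' x).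
Proof.
rewrite /mon_act; elim: (enum _) => //= i s ->.
by rewrite mnmDE iterD iter_mon.
Qed.

Lemma mon_act1 x : mon_act 0%MM x = x.
Proof. by rewrite /mon_act; elim: (enum _) => //= i s ->; rewrite mnmE. Qed.

Lemma poly_actE p n x : (msize p <= n)%N ->
  poly_act p x = \sum_(m : 'X_{1..c < n}) p@_m *: mon_act m x.
Proof.
move=> le_pn; set I : subFinType _ := 'X_{1..c < n}.
rewrite /poly_act (big_mksub I) ?msupp_uniq //=; first last.
  by move=> m /msize_mdeg_lt /leq_trans; apply.
by rewrite big_rmcond //= => m /memN_msupp_eq0 ->; rewrite scale0r.
Qed.

Lemma poly_actP a p q x : poly_act (a *: p + q) x = a *: poly_act p x + poly_act q x.
Proof.
pose n := maxn (msize (a *: p + q)) (maxn (msize p) (msize q)).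
rewrite !(@poly_actE _ n) ?leq_max ?leqnn ?orbT //.
rewrite scaler_sumr -big_split; apply: eq_bigr => m _ /=.
by rewrite mcoeffD mcoeffZ scalerDl scalerA.
Qed.

Lemma poly_act0 x : poly_act 0 x = 0.
Proof. by rewrite /poly_act msupp0 big_nil. Qed.

Lemma poly_actZ a p x : poly_act (a *: p) x = a *: poly_act p x.
Proof. by rewrite -[a *: p]addr0 poly_actP poly_act0 addr0. Qed.

Lemma poly_actDl x : {morph poly_act^~ x : p q / p + q}.
Proof. by move=> p q; rewrite -[p in LHS]scale1r poly_actP scale1r. Qed.

Lemma poly_actDr : right_distributive poly_act +%R.
Proof.
move=> p x y; rewrite /poly_act -big_split; apply: eq_bigr => m _ /=.
by rewrite mon_actD scalerDr.
Qed.

Lemma poly_actX m x : poly_act 'X_[m] x = mon_act m x.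
Proof. by rewrite /poly_act msuppX big_seq1 mcoeffX eqxx scale1r. Qed.

Lemma poly_act1 : left_id 1 poly_act.
Proof. by move=> x; rewrite -mpolyX0 poly_actX mon_act1. Qed.

Lemma poly_actZr p a x : poly_act p (a *: x) = a *: poly_act p x.
Proof.
rewrite /poly_act scaler_sumr; apply: eq_bigr => m _.
by rewrite mon_actZ !scalerA mulrC.
Qed.

Lemma poly_act_sum (I : Type) (r : seq I) p (y : I -> L) :
  poly_act p (\sum_(i <- r) y i) = \sum_(i <- r) poly_act p (y i).
Proof.
elim: r => [|i r IHr]; last by rewrite !big_cons poly_actDr IHr.
by rewrite !big_nil -[X in poly_act p X](scale0r (0 : L)) poly_actZr scale0r.
Qed.

Lemma mon_act_poly m p x : mon_act m (poly_act p x) = poly_act ('X_[m] * p) x.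
Proof.
rewrite [p in RHS]mpolyE mulr_sumr /poly_act; move: (msupp p) => s.
elim: s => [|m' s IHs]; first by rewrite !big_nil msupp0 big_nil mon_act0.
rewrite !big_cons mon_actP IHs -/(poly_act _ x) -/(poly_act _ x).
by rewrite -scalerAr poly_actP -mpolyXD poly_actX mon_actM.
Qed.

Lemma poly_actA p q x : poly_act p (poly_act q x) = poly_act (p * q) x.
Proof.
elim/mpolyind: p => [|a m p _ _ IHp]; first by rewrite mul0r !poly_act0.
by rewrite mulrDl -scalerAl !poly_actP IHp poly_actX mon_act_poly.
Qed.

Lemma poly_act_var i x : poly_act 'X_i x = op i x.
Proof.
rewrite poly_actX /mon_act; have := mem_enum 'I_c i; rewrite inE.
have := enum_uniq 'I_c; elim: (enum _) => //= l s IHs /andP[l_s Us].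
rewrite inE mnmE => /predU1P[i_l | s_i]; last first.
  by rewrite IHs //; case: eqP => // i_l; rewrite -i_l s_i in l_s.
rewrite i_l eqxx /=; congr (op l _).
have {IHs i_l}: l \notin s by [].
elim: s {Us l_s} => //= l' s IHs; rewrite inE negb_or => /andP[/negPf nl l_s].
by rewrite mnmE nl /= IHs.
Qed.

End PolyAction.

(* A separate copy of gr_sum, as that type already carries a k-module
   structure. *)
Section TotalModule.
Variables (k : fieldType) (c : nat) (N : grmod k c).

Definition gr_total := gr_sum N.
HB.instance Definition _ := GRing.Zmodule.on gr_total.

Definition gr_act (p : {mpoly k[c]}) (x : gr_total) : gr_total :=
  poly_act (fun i => @gr_shift k c N i) p x.

HB.instance Definition _ := @GRing.Zmodule_isLmodule.Build {mpoly k[c]} gr_total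
  gr_act (poly_actA (@gr_shiftC k c N)) (@poly_act1 _ _ _ (fun i => @gr_shift k c N i))
  (@poly_actDr _ _ _ (fun i => @gr_shift k c N i))
  (@poly_actDl _ _ _ (fun i => @gr_shift k c N i)).

Lemma gr_total_varE i (x : gr_total) j :
  gr_comp ('X_i *: x) j.+1 = gr_chi N i j (gr_comp x j).
Proof. by rewrite /GRing.scale /= /gr_act poly_act_var. Qed.

Definition gr_in0_comp (x : gr_deg N 0) (j : nat) : gr_deg N j :=
  match j with
  | 0 => x
  | _.+1 => 0
  end.

Fact gr_fin_in0 x : exists n, forall j, (n <= j)%N -> gr_in0_comp x j = 0.
Proof. by exists 1%N => -[]. Qed.

Definition gr_in0 (x : gr_deg N 0) : gr_total := GrSum (gr_fin_in0 x).

End TotalModule.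

(* Ext_R^even(M, k), graded so that Ext_R^{2j} sits in degree j. *)
Section EvenExt.
Variables (S : comUnitRingType) (k : fieldType) (R : comNzRingType) (c : nat).
Variables (X : ci_setting S k R c) (M : lmodType R).
Variables (F : free_resolution (idfun : {rmorphism R -> R}) M) (L : ci_lift X F).

Definition ext_even_gr : grmod k c :=
  @GrMod k c (fun j => extR X F j.*2) (fun i j => @ext_chi _ _ _ _ _ _ _ L i j.*2)
    (fun i l j x => ext_chiC L i l x).

Definition ext_even : lmodType {mpoly k[c]} := gr_total ext_even_gr.

Definition ext_even_in0 (x : extR X F 0) : ext_even := @gr_in0 k c ext_even_gr x.

End EvenExt.

Section FreeExtension.
Variables (k : fieldType) (c : nat) (V : vectType k).

(* Row vectors over k[chi_1, ..., chi_c], in the coordinates of the library's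
   basis of V. *)
Definition tens : lmodType {mpoly k[c]} := 'rV[{mpoly k[c]}]_(\dim {:V}).

Definition pure (v : V) (p : {mpoly k[c]}) : tens :=
  \row_i (coord (vbasis {:V}) i v *: p).

End FreeExtension.

(* mu^dual : Ext_S^1(M, k) -> Hom(M, k) (x) R_1.  As chi_1, ..., chi_c is dual
   to e_1, ..., e_c, a functional a on E_1 (x) Tor_0 corresponds to
   \sum_j a (e_j (x) -) (x) chi_j in Hom_k(Tor_0, k) (x) R_1. *)
Definition mu_dual (S : comUnitRingType) (k : fieldType) (R : comNzRingType)
    (c : nat) (X : ci_setting S k R c) (M : lmodType R)
    (G : free_resolution (quo X) M) (sg : homotopies G) (w : extS G 1) :
    tens c (extS G 0) :=
  \sum_j pure (w \o mu sg j)%VF 'X_j.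

(* v in Hom_k(Tor_0^S(M, k), k) = Hom(M, k) and x in Ext_R^0(M, k) = Hom(M, k)
   both come from the same homomorphism phi : M -> k. *)
Definition same_hom (S : comUnitRingType) (k : fieldType) (R : comNzRingType)
    (c : nat) (X : ci_setting S k R c) (M : lmodType R)
    (G : free_resolution (quo X) M)
    (F : free_resolution (idfun : {rmorphism R -> R}) M)
    (v : extS G 0) (x : extR X F 0) : Prop :=
  exists phi : {linear M -> k^o | resR X \; *%R},
    (forall y, phi (aug G y) = v (tor_cls G 0 (map_mx (res X) y))) /\
    x = ext_cls X F 0 (\col_i phi (aug F (delta_mx 0 i))).

(* Main.v *)
Require Import Defs.
From HB Require Import structures.
From mathcomp Require Import all_boot all_order all_algebra.
From mathcomp Require Import boolp.
From mathcomp.multinomials Require Import mpoly.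
From Stdlib Require Import Setoid Morphisms.

Set Implicit Arguments.
Unset Strict Implicit.
Unset Printing Implicit Defensive.

Import GRing.Theory.
Local Open Scope ring_scope.

(* Let M(p) be the module of the p-th stage of the factorization and write
   R_p = S / (f_1, ..., f_p).  The claim that Ext_{R_p}(M(p), k) has a linear
   presentation over k[chi_1, ..., chi_p] (generators in degrees 0 and 1) goes by
   induction on p.  Over R_{p-1}, a resolution of M(p) arises from one of M(p-1)
   by enlarging the first two terms, which changes Ext only in degrees 0 and 1.
   Over R_p, the cone of chi_p gives Ext_{R_{p-1}} = Ext_{R_p} / chi_p, provided
   that chi_p is injective; since Ext_{R_{p-1}} is generated in degrees 0 and 1,
   this reduces to degree 0, where it follows from the minimality of h_p.
   All resolutions are handled as matrices over S up to congruence modulo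
   (f_1, ..., f_p), indexed from 0.

   It remains to identify the relations of degree 1, which is possible for every
   R-module M: the sequence
     Ext_S^1(M, k) -> Hom(M, k) (x) R_1 -> Ext_R^2(M, k)
   is exact, because both \sum_j f_j t_j and the homotopies for the f_j measure
   the failure of a lifted R-resolution to be a complex over S. *)

(** * Lifted resolutions *)

(** On the box complex each operator [chi_q] factors through the inclusion of the previous stage, so
    the generators added by the new stage are killed by all earlier operators, up to multiples of
    the newest one. This is why linear relations occur, and why [rel_step], a regular-sequence
    condition, can only start in degree 2. The newest operator is injective in every degree and is
    divided out first; hence the sums in [rel_step] run over the larger indices. Only even degrees
    enter the theorem, but both parities are carried along: the cone shifts degrees by one, so
    injectivity in even degrees is extracted from generation in odd degrees, and conversely. The
    box, the cone and the given resolution are different complexes for the same module. No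
    minimality of resolutions is assumed; properties are moved along [retract]. A relation of degree
    at least 2 is reduced by eliminating one variable at a time, starting with the smallest index:
    [rel_step] trades the coefficient of [chi_q] for changes in the later coefficients and a
    relation of lower degree. *)

Section Congruence.
Variables (S : comUnitRingType) (f : nat -> S).

(** The sequence is indexed by all naturals and cut off at [p], so the induction on the number of
    relations involves no change of index type. *)
Definition in_ideal p m n (A : 'M[S]_(m, n)) : Prop :=
  exists u : nat -> 'M[S]_(m, n), A = \sum_(j < p) f j *: u j.

Definition eqmodI p m n (A B : 'M[S]_(m, n)) : Prop := in_ideal p (A - B).

Lemma in_ideal0 p m n : in_ideal p (0 : 'M[S]_(m, n)).
Proof. by exists (fun=> 0); rewrite big1 // => j _; rewrite scaler0. Qed.

Lemma in_idealD p m n (A B : 'M[S]_(m, n)) :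
  in_ideal p A -> in_ideal p B -> in_ideal p (A + B).
Proof.
move=> [u ->] [v ->]; exists (fun j => u j + v j).
by rewrite -big_split; apply: eq_bigr => j _; rewrite scalerDr.
Qed.

Lemma in_idealN p m n (A : 'M[S]_(m, n)) : in_ideal p A -> in_ideal p (- A).
Proof.
move=> [u ->]; exists (fun j => - u j); rewrite -sumrN.
by apply: eq_bigr => j _; rewrite scalerN.
Qed.

Lemma in_idealMl p m n l (A : 'M[S]_(m, n)) (B : 'M_(l, m)) :
  in_ideal p A -> in_ideal p (B *m A).
Proof.
move=> [u ->]; exists (fun j => B *m u j); rewrite mulmx_sumr.
by apply: eq_bigr => j _; rewrite scalemxAr.
Qed.

Lemma in_idealMr p m n l (A : 'M[S]_(m, n)) (B : 'M_(n, l)) :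
  in_ideal p A -> in_ideal p (A *m B).
Proof.
move=> [u ->]; exists (fun j => u j *m B); rewrite mulmx_suml.
by apply: eq_bigr => j _; rewrite scalemxAl.
Qed.

Lemma in_idealZ p m n s (A : 'M[S]_(m, n)) : in_ideal p A -> in_ideal p (s *: A).
Proof. by move=> /(in_idealMl s%:M); rewrite mul_scalar_mx. Qed.

Lemma in_ideal_sum p m n (u : nat -> 'M[S]_(m, n)) :
  in_ideal p (\sum_(j < p) f j *: u j).
Proof. by exists u. Qed.

Lemma in_idealS p m n (A : 'M[S]_(m, n)) :
  in_ideal p.+1 A <-> exists B, in_ideal p (A - f p *: B).
Proof.
split=> [[u ->]|[B [u uE]]].
  by exists (u p); rewrite big_ord_recr /= addrK; apply: in_ideal_sum.
exists (fun j => if j == p then B else u j).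
rewrite big_ord_recr /= eqxx -[LHS](subrK (f p *: B)) uE; congr (_ + _).
by apply: eq_bigr => j _; rewrite ltn_eqF.
Qed.

Lemma eqmodI_refl p m n : Reflexive (@eqmodI p m n).
Proof. by move=> A; rewrite /eqmodI subrr; apply: in_ideal0. Qed.

Lemma eqmodI_sym p m n : Symmetric (@eqmodI p m n).
Proof. by move=> A B /in_idealN; rewrite opprB. Qed.

Lemma eqmodI_trans p m n : Transitive (@eqmodI p m n).
Proof. by move=> A B C AB BC; have := in_idealD AB BC; rewrite addrA subrK. Qed.

#[global] Instance eqmodI_equiv p m n : Equivalence (@eqmodI p m n).
Proof. split; [exact: eqmodI_refl|exact: eqmodI_sym|exact: eqmodI_trans]. Qed.

#[global] Instance eqmodI_mul p m n l :
  Proper (@eqmodI p m n ==> @eqmodI p n l ==> @eqmodI p m l) mulmx.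
Proof.
move=> A B AB C D CD; apply: (@eqmodI_trans _ _ _ _ (B *m C)).
  by rewrite /eqmodI -mulmxBl; apply: in_idealMr.
by rewrite /eqmodI -mulmxBr; apply: in_idealMl.
Qed.

#[global] Instance eqmodI_add p m n :
  Proper (@eqmodI p m n ==> @eqmodI p m n ==> @eqmodI p m n) +%R.
Proof. by move=> A B AB C D CD; rewrite /eqmodI opprD addrACA; apply: in_idealD. Qed.

#[global] Instance eqmodI_opp p m n :
  Proper (@eqmodI p m n ==> @eqmodI p m n) -%R.
Proof. by move=> A B AB; rewrite /eqmodI -opprD; apply: in_idealN. Qed.

#[global] Instance eqmodI_scale p m n s :
  Proper (@eqmodI p m n ==> @eqmodI p m n) ( *:%R s).
Proof. by move=> A B AB; rewrite /eqmodI -scalerBr; apply: in_idealZ. Qed.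

Lemma eqmodI0 p m n (A : 'M[S]_(m, n)) : eqmodI p A 0 <-> in_ideal p A.
Proof. by rewrite /eqmodI subr0. Qed.


Local Notation "A ~[ p ] B" := (eqmodI p A B) (at level 70, no associativity).

Lemma in_ideal_entries p m n (A : 'M[S]_(m, n)) :
  (forall i j, @in_ideal p 1 1 (A i j)%:M) -> in_ideal p A.
Proof.
move=> H; have {H}/choice[u uE] (x : 'I_m * 'I_n) :
    exists u : nat -> S, A x.1 x.2 = \sum_(j < p) f j * u j.
  have [u uE] := H x.1 x.2; exists (fun j => u j 0 0).
  move/(congr1 (fun B : 'M_1 => B 0 0)): uE; rewrite mxE eqxx mulr1n summxE => ->.
  by apply: eq_bigr => j _; rewrite mxE.
exists (fun l => \matrix_(i, j) u (i, j) l); apply/matrixP => i j.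
by rewrite (uE (i, j)) summxE; apply: eq_bigr => l _; rewrite !mxE.
Qed.

(* A resolution over S / (f_0, ..., f_{p-1}), lifted to S: ld is the lifted
   differential and lop j the operator t_j with ld^2 = \sum_j f_j t_j. *)
Record lcplx := LCplx {
  lrk : nat -> nat;
  ld : forall i, 'M[S]_(lrk i.+1, lrk i);
  lop : nat -> forall i, 'M[S]_(lrk i.+2, lrk i)
}.

(* Acyclicity in positive degrees only; the resolved module is the cokernel of
   ld C 0 modulo the ideal. *)
Definition resolves p (C : lcplx) : Prop :=
  (forall i, ld C i.+1 *m ld C i = \sum_(j < p) f j *: lop C j i) /\
  (forall i m (x : 'M_(m, lrk C i.+1)), x *m ld C i ~[p] 0 ->
     exists y, x ~[p] y *m ld C i.+1).

Lemma resolves_dd p C i : resolves p C -> ld C i.+1 *m ld C i ~[p] 0.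
Proof.
by move=> [-> _]; rewrite eqmodI0; apply: (in_ideal_sum p (fun j => lop C j i)).
Qed.

(* Modulo (f_0, ..., f_{p-1}), coker D is a retract of coker E. *)
Definition retract p m0 m1 n0 n1 (D : 'M[S]_(m1, m0)) (E : 'M[S]_(n1, n0)) :=
  exists (a0 : 'M_(m0, n0)) (b0 : 'M_(n0, m0)) (a1 : 'M_(m1, n1))
         (b1 : 'M_(n1, m1)) (s0 : 'M_(m0, m1)),
    [/\ D *m a0 ~[p] a1 *m E, E *m b0 ~[p] b1 *m D &
        a0 *m b0 ~[p] 1%:M + s0 *m D].

Lemma eqmodI_sub0 p m n (A B : 'M[S]_(m, n)) : A ~[p] B <-> A - B ~[p] 0.
Proof. by rewrite eqmodI0. Qed.

Section ChainMap.
Variables (p : nat) (C C' : lcplx).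
Hypotheses (resC : resolves p C) (resC' : resolves p C').

Lemma chain_map_ex (a0 : 'M_(lrk C 0, lrk C' 0)) a1 :
    ld C 0 *m a0 ~[p] a1 *m ld C' 0 ->
  exists a : forall n, 'M_(lrk C n, lrk C' n),
    a 0%N = a0 /\ forall n, ld C n *m a n ~[p] a n.+1 *m ld C' n.
Proof.
move=> a01.
(* Each stage of the recursion stores two consecutive components with the square they form, because
   lifting the next component uses that square. *)
pose T n := {x : 'M_(lrk C n, lrk C' n) * 'M_(lrk C n.+1, lrk C' n.+1) |
              ld C n *m x.1 ~[p] x.2 *m ld C' n}.
have step n (x : T n) : {y : T n.+1 | (sval y).1 = (sval x).2}.
  case: x => -[u v] /= uv; apply: cid.
  have [w vw] : exists w, ld C n.+1 *m v ~[p] w *m ld C' n.+1.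
    apply: resC'.2; rewrite -mulmxA -uv mulmxA resolves_dd // mul0mx.
    by reflexivity.
  by exists (exist (fun x => ld C n.+1 *m x.1 ~[p] x.2 *m ld C' n.+1) (v, w) vw).
pose g := fix g n : T n := match n with
  | 0 => exist (fun x => ld C 0%N *m x.1 ~[p] x.2 *m ld C' 0%N) (a0, a1) a01
  | n.+1 => sval (step n (g n)) end.
exists (fun n => (sval (g n)).1); split=> // n.
have -> : (sval (g n.+1)).1 = (sval (g n)).2 by exact: (svalP (step n (g n))).
exact: (svalP (g n)).
Qed.

End ChainMap.

(** Existence is recorded degree by degree, without a single family of homotopies; cohomology is
    compared one degree at a time. *)
Lemma homotopy_ex p C (phi : forall n, 'M_(lrk C n)) s0 : resolves p C ->
    (forall n, ld C n *m phi n ~[p] phi n.+1 *m ld C n) ->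
    phi 0%N ~[p] s0 *m ld C 0%N ->
  forall n, exists s s', phi n.+1 ~[p] s' *m ld C n.+1 + ld C n *m s.
Proof.
move=> resC phiD phi0.
have next n s : (phi n.+1 - ld C n *m s) *m ld C n ~[p] 0 ->
    exists s', phi n.+1 ~[p] s' *m ld C n.+1 + ld C n *m s.
  move=> /(resC.2 _ _ _)[s' s'P]; exists s'; rewrite -s'P subrK.
  by reflexivity.
elim=> [|n [s [s' ss']]].
  have [s' s'P] : exists s', phi 1%N ~[p] s' *m ld C 1%N + ld C 0%N *m s0.
    by apply: next; rewrite mulmxBl -phiD -mulmxA -phi0 subrr; reflexivity.
  by exists s0, s'.
have [s'' s''P] : exists s'', phi n.+2 ~[p] s'' *m ld C n.+2 + ld C n.+1 *m s'.
  apply: next; rewrite mulmxBl -phiD ss' mulmxDr !mulmxA resolves_dd // mul0mx.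
  by rewrite addr0 subrr; reflexivity.
by exists s', s''.
Qed.


Definition regular_upto c : Prop :=
  forall p s, (p < c)%N -> @in_ideal p 1 1 (f p *: s%:M) -> @in_ideal p 1 1 s%:M.

Lemma regular_mx c p m n (A : 'M[S]_(m, n)) : regular_upto c -> (p < c)%N ->
  f p *: A ~[p] 0 -> A ~[p] 0.
Proof.
move=> freg pc /eqmodI0[u uE]; apply/eqmodI0/in_ideal_entries => i j.
apply: freg => //; exists (fun l => (u l i j)%:M); rewrite scale_scalar_mx.
have -> : f p * A i j = \sum_(l < p) f l * u l i j.
  have := congr1 (fun B : 'M_(m, n) => B i j) uE; rewrite mxE summxE => ->.
  by apply: eq_bigr => l _; rewrite mxE.
by rewrite raddf_sum; apply: eq_bigr => l _; rewrite scale_scalar_mx.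
Qed.

(** Regularity puts the last coefficient of a syzygy in the span of the earlier f_j, say A_p = sum
    f_j B_j; then the A_j + f_p B_j form a shorter syzygy. This allows coefficients of the f_j to be
    compared in an identity over S. *)
Lemma regular_mx_sum c p m n (A : nat -> 'M[S]_(m, n)) : regular_upto c ->
    (p <= c)%N -> \sum_(j < p) f j *: A j = 0 ->
  forall j, (j < p)%N -> A j ~[p] 0.
Proof.
move=> freg; elim: p A => // p IHp A pc sA j.
have [B Bp] : exists B : nat -> 'M_(m, n), A p = \sum_(j < p) f j *: B j.
  apply/eqmodI0/(regular_mx freg pc)/eqmodI0; exists (fun j => - A j).
  move/eqP: sA; rewrite big_ord_recr /= addrC addr_eq0 => /eqP ->.
  by rewrite -sumrN; apply: eq_bigr => l _; rewrite scalerN.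
have weaken (C : 'M_(m, n)) : C ~[p] 0 -> C ~[p.+1] 0.
  move=> /eqmodI0 C0; apply/eqmodI0/in_idealS; exists 0.
  by rewrite scaler0 subr0.
rewrite ltnS leq_eqVlt => /predU1P[->|jp].
  by apply/weaken/eqmodI0; exists B.
have s0 : \sum_(j < p) f j *: (A j + f p *: B j) = 0.
  rewrite -[RHS]sA big_ord_recr /= Bp scaler_sumr -big_split.
  by apply: eq_bigr => l _; rewrite scalerDr !scalerA mulrC.
have /weaken AB := IHp (fun j => A j + f p *: B j) (ltnW pc) s0 j jp.
have -> : A j = A j + f p *: B j - f p *: B j by rewrite addrK.
rewrite AB add0r; apply/eqmodI0/in_idealN/in_idealS; exists (B j).
by rewrite subrr; apply: in_ideal0.
Qed.

End Congruence.

(** * Cohomology of reduced complexes and its behaviour under retracts *)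

Section Reduction.
Variables (S : comUnitRingType) (k : fieldType) (res : {rmorphism S -> k}).
Variable f : nat -> S.
Hypothesis f_res : forall j, res (f j) = 0.
Variable c : nat.
Hypothesis f_reg : regular_upto f c.

Local Notation "A ~[ p ] B" := (eqmodI f p A B) (at level 70, no associativity).
Local Notation "A ^r" := (map_mx res A) (at level 2, format "A ^r").
Local Notation lcplx := (lcplx S).

Lemma res_eqmodI p m n (A B : 'M[S]_(m, n)) : A ~[p] B -> A^r = B^r.
Proof.
move=> [u uE]; apply/eqP; rewrite -subr_eq0 -map_mxB uE map_mx_sum big1 // => j _.
by rewrite map_mxZ f_res scale0r.
Qed.

Definition cocycle (C : lcplx) n (z : 'cV[k]_(lrk C n)) : Prop := (ld C n)^r *m z = 0.

(* Ext is generated over k[chi_0, ..., chi_{p-1}] in degrees 0 and 1. *)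
Definition gen_step p (C : lcplx) : Prop :=
  forall n (z : 'cV_(lrk C n.+2)), cocycle z ->
  exists (w : nat -> 'cV_(lrk C n)) y, (forall j, cocycle (w j)) /\
    z = \sum_(j < p) (lop C j n)^r *m w j + (ld C n.+1)^r *m y.

(* In degrees >= 2, chi_q is a nonzerodivisor on the quotient of Ext by
   chi_{q+1}, ..., chi_{p-1}; with gen_step this forces linear presentations. *)
Definition rel_step p (C : lcplx) : Prop :=
  forall n q (z : nat -> 'cV_(lrk C n.+2)), (q < p)%N ->
    (forall j, cocycle (z j)) ->
    (exists y, \sum_(q <= j < p) (lop C j n.+2)^r *m z j = (ld C n.+3)^r *m y) ->
  exists w y, (forall j, cocycle (w j)) /\
    z q = \sum_(q.+1 <= j < p) (lop C j n)^r *m w j + (ld C n.+1)^r *m y.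

Lemma lop_chain p (C : lcplx) j n : resolves f p C -> (p <= c)%N -> (j < p)%N ->
  ld C n.+2 *m lop C j n ~[p] lop C j n.+1 *m ld C n.
Proof.
move=> resC pc jp; apply/eqmodI_sub0.
apply: (regular_mx_sum (A := fun j => ld C n.+2 *m lop C j n - lop C j n.+1 *m ld C n)
  f_reg pc _ jp).
under eq_bigr do rewrite scalerBr.
rewrite sumrB; apply/eqP; rewrite subr_eq0; apply/eqP.
transitivity (ld C n.+2 *m (ld C n.+1 *m ld C n)).
  by rewrite resC.1 mulmx_sumr; apply: eq_bigr => i _; rewrite scalemxAr.
by rewrite mulmxA resC.1 mulmx_suml; apply: eq_bigr => i _; rewrite scalemxAl.
Qed.

Lemma lop_chain_res p (C : lcplx) j n : resolves f p C -> (p <= c)%N -> (j < p)%N ->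
  (ld C n.+2)^r *m (lop C j n)^r = (lop C j n.+1)^r *m (ld C n)^r.
Proof. by move=> rC pc jp; rewrite -!map_mxM (res_eqmodI (lop_chain n rC pc jp)). Qed.

Lemma ld_ld_res p (C : lcplx) n : resolves f p C -> (ld C n.+1)^r *m (ld C n)^r = 0.
Proof. by move=> rC; rewrite -map_mxM (res_eqmodI (resolves_dd n rC)) map_mx0. Qed.

(** The homotopies are the coefficients of the f_j in the defect of [a] from being a chain map over
    S; comparing coefficients after inserting them into d d a makes the sum telescope. *)
Lemma lop_natural p (C C' : lcplx) (a : forall n, 'M_(lrk C n, lrk C' n)) :
    resolves f p C -> resolves f p C' -> (p <= c)%N ->
    (forall n, ld C n *m a n ~[p] a n.+1 *m ld C' n) ->
  exists g : nat -> forall n, 'M_(lrk C n.+1, lrk C' n), forall n j, (j < p)%N ->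
    lop C j n *m a n ~[p] a n.+2 *m lop C' j n + g j n.+1 *m ld C' n + ld C n.+1 *m g j n.
Proof.
move=> rC rC' pc aD.
pose g n := sval (cid (aD n)).
have gP n : ld C n *m a n - a n.+1 *m ld C' n = \sum_(j < p) f j *: g n j.
  exact: (svalP (cid (aD n))).
exists (fun j n => g n j) => n j jp; apply/eqmodI_sub0.
apply: (regular_mx_sum (A := fun j => lop C j n *m a n - (a n.+2 *m lop C' j n +
  g n.+1 j *m ld C' n + ld C n.+1 *m g n j)) f_reg pc _ jp).
under eq_bigr do rewrite scalerBr !scalerDr.
rewrite sumrB !big_split /=.
have -> : \sum_(j < p) f j *: (lop C j n *m a n) = ld C n.+1 *m ld C n *m a n.
  by rewrite rC.1 mulmx_suml; apply: eq_bigr => i _; rewrite scalemxAl.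
have -> : \sum_(j < p) f j *: (a n.+2 *m lop C' j n) = a n.+2 *m (ld C' n.+1 *m ld C' n).
  by rewrite rC'.1 mulmx_sumr; apply: eq_bigr => i _; rewrite scalemxAr.
have -> : \sum_(j < p) f j *: (g n.+1 j *m ld C' n) =
    (ld C n.+1 *m a n.+1 - a n.+2 *m ld C' n.+1) *m ld C' n.
  by rewrite gP mulmx_suml; apply: eq_bigr => i _; rewrite scalemxAl.
have -> : \sum_(j < p) f j *: (ld C n.+1 *m g n j) =
    ld C n.+1 *m (ld C n *m a n - a n.+1 *m ld C' n).
  by rewrite gP mulmx_sumr; apply: eq_bigr => i _; rewrite scalemxAr.
have telescope (V : zmodType) (x y z : V) : x - (y + (z - y) + (x - z)) = 0.
  by rewrite [y + _]addrC subrK [z + _]addrC subrK subrr.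
by rewrite mulmxBl mulmxBr !mulmxA telescope.
Qed.

Section Retract.
Variables (p : nat) (C C' : lcplx).
Hypotheses (pc : (p <= c)%N) (rC : resolves f p C) (rC' : resolves f p C').
Hypothesis CC' : retract f p (ld C 0) (ld C' 0).

(** Congruences become equalities over k, since the f_j reduce to 0. In positive degrees the
    cohomology of [C] becomes a retract of that of [C'], compatibly with the operators. *)
Lemma retract_cohomology :
  exists (a : forall n, 'M[k]_(lrk C n, lrk C' n)) (b : forall n, 'M[k]_(lrk C' n, lrk C n))
    (ga : nat -> forall n, 'M[k]_(lrk C n.+1, lrk C' n))
    (gb : nat -> forall n, 'M[k]_(lrk C' n.+1, lrk C n)),
  [/\ (forall n, (ld C n)^r *m a n = a n.+1 *m (ld C' n)^r),
      (forall n, (ld C' n)^r *m b n = b n.+1 *m (ld C n)^r),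
      (forall n j, (j < p)%N -> (lop C j n)^r *m a n = a n.+2 *m (lop C' j n)^r +
         ga j n.+1 *m (ld C' n)^r + (ld C n.+1)^r *m ga j n),
      (forall n j, (j < p)%N -> (lop C' j n)^r *m b n = b n.+2 *m (lop C j n)^r +
         gb j n.+1 *m (ld C n)^r + (ld C' n.+1)^r *m gb j n) &
      (forall n (z : 'cV_(lrk C n.+1)), cocycle z ->
         exists y, a n.+1 *m (b n.+1 *m z) = z + (ld C n)^r *m y)].
Proof.
have [a0 [b0 [a1 [b1 [s0 [a01 b01 ab0]]]]]] := CC'.
have [a [aE aP]] := chain_map_ex rC rC' a01.
have [b [bE bP]] := chain_map_ex rC' rC b01.
have [ga gaP] := lop_natural rC rC' pc aP.
have [gb gbP] := lop_natural rC' rC pc bP.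
exists (fun n => (a n)^r), (fun n => (b n)^r), (fun j n => (ga j n)^r),
  (fun j n => (gb j n)^r); split=> [n|n|n j jp|n j jp|n z Zz].
- by rewrite -!map_mxM (res_eqmodI (aP n)).
- by rewrite -!map_mxM (res_eqmodI (bP n)).
- by rewrite -!map_mxM -!map_mxD (res_eqmodI (gaP n j jp)).
- by rewrite -!map_mxM -!map_mxD (res_eqmodI (gbP n j jp)).
pose phi n := a n *m b n - 1%:M.
have phiD m : ld C m *m phi m ~[p] phi m.+1 *m ld C m.
  rewrite /phi mulmxBr mulmxBl mulmx1 mul1mx mulmxA aP -mulmxA bP mulmxA.
  by reflexivity.
have phi0 : phi 0%N ~[p] s0 *m ld C 0.
  by rewrite /phi aE bE ab0 addrAC subrr add0r; reflexivity.
have [s [s' ss']] := homotopy_ex rC phiD phi0 n.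
have /(congr1 (fun A => A *m z)) := res_eqmodI ss'.
rewrite map_mxB map_mx1 mulmxBl mul1mx map_mxD !map_mxM mulmxDl -!mulmxA Zz.
rewrite mulmx0 add0r => /eqP; rewrite subr_eq => /eqP abz.
by exists (s^r *m z); rewrite abz addrC.
Qed.

Lemma gen_step_retract : gen_step p C' -> gen_step p C.
Proof.
have [a [b [ga [_ [aD bD aT _ ab]]]]] := retract_cohomology.
move=> genC' n z Zz.
have bz : cocycle (b n.+2 *m z) by rewrite /cocycle mulmxA bD -mulmxA Zz mulmx0.
have [w [y [Zw zE]]] := genC' n _ bz.
have [y' y'E] := ab _ z Zz.
(* The three terms of the second witness transport the coboundary, correct the failure of [a] to
   commute with the operators, and undo the homotopy from the composite to the identity. *)
exists (fun j => a n *m w j), (a n.+1 *m y - \sum_(j < p) ga j n *m w j - y').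
split=> [j|]; first by rewrite /cocycle mulmxA aD -mulmxA Zw mulmx0.
rewrite !mulmxBr addrA -[LHS](addrK ((ld C n.+1)^r *m y')) -y'E; congr (_ - _).
rewrite zE mulmxDr mulmx_sumr mulmx_sumr addrA addrAC; congr (_ + _); last first.
  by rewrite mulmxA -aD mulmxA.
rewrite -sumrB; apply: eq_bigr => j _.
rewrite !mulmxA aT // !mulmxDl -[_ *m (ld C' n)^r *m _]mulmxA Zw mulmx0 addr0.
by rewrite addrK.
Qed.

Lemma rel_step_retract : rel_step p C' -> rel_step p C.
Proof.
have [a [b [ga [gb [aD bD aT bT ab]]]]] := retract_cohomology.
move=> relC' n q z qp Zz [y yE].
have Zb m (x : 'cV_(lrk C m)) : cocycle x -> cocycle (b m *m x).
  by move=> Zx; rewrite /cocycle mulmxA bD -mulmxA Zx mulmx0.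
have [||w [y0 [Zw zE]]] := relC' n q (fun j => b n.+2 *m z j) qp.
- by move=> j; apply: Zb.
- exists (b n.+3 *m y + \sum_(q <= j < p) gb j n.+2 *m z j).
  rewrite mulmxDr mulmxA bD -mulmxA -yE !mulmx_sumr -big_split.
  rewrite [LHS]big_nat [RHS]big_nat; apply: eq_bigr => j /andP[_ jp] /=.
  rewrite mulmxA bT // !mulmxDl -[_ *m (ld C n.+2)^r *m _]mulmxA Zz mulmx0 addr0.
  by rewrite !mulmxA.
have [y' y'E] := ab _ (z q) (Zz q).
exists (fun j => a n *m w j), (a n.+1 *m y0 - \sum_(q.+1 <= j < p) ga j n *m w j - y').
split=> [j|]; first by rewrite /cocycle mulmxA aD -mulmxA Zw mulmx0.
rewrite !mulmxBr addrA -[LHS](addrK ((ld C n.+1)^r *m y')) -y'E; congr (_ - _).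
rewrite zE mulmxDr mulmx_sumr mulmx_sumr addrA addrAC; congr (_ + _); last first.
  by rewrite mulmxA -aD mulmxA.
rewrite -sumrB [LHS]big_nat [RHS]big_nat; apply: eq_bigr => j /andP[_ jp].
rewrite !mulmxA aT // !mulmxDl -[_ *m (ld C' n)^r *m _]mulmxA Zw mulmx0 addr0.
by rewrite addrK.
Qed.

End Retract.

End Reduction.

(** * The cone of a CI operator *)

Section BlockSums.
Variables (V : pzRingType) (m m' n n' : nat).

Lemma sum_row_mx p (A : nat -> 'M[V]_(m, n)) (B : nat -> 'M[V]_(m, n')) :
  \sum_(j < p) row_mx (A j) (B j) = row_mx (\sum_(j < p) A j) (\sum_(j < p) B j).
Proof.
elim: p => [|p IHp]; first by rewrite !big_ord0 row_mx0.
by rewrite !big_ord_recr /= IHp add_row_mx.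
Qed.

Lemma sum_col_mx p (A : nat -> 'M[V]_(m, n)) (B : nat -> 'M[V]_(m', n)) :
  \sum_(j < p) col_mx (A j) (B j) = col_mx (\sum_(j < p) A j) (\sum_(j < p) B j).
Proof.
elim: p => [|p IHp]; first by rewrite !big_ord0 col_mx0.
by rewrite !big_ord_recr /= IHp add_col_mx.
Qed.

Lemma sum_block_mx p (A : nat -> 'M[V]_(m, n))
  (B : nat -> 'M[V]_(m, n')) (C : nat -> 'M[V]_(m', n)) (D : nat -> 'M[V]_(m', n')) :
  \sum_(j < p) block_mx (A j) (B j) (C j) (D j) =
  block_mx (\sum_(j < p) A j) (\sum_(j < p) B j) (\sum_(j < p) C j) (\sum_(j < p) D j).
Proof.
elim: p => [|p IHp]; first by rewrite !big_ord0 /block_mx !row_mx0 col_mx0.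
by rewrite !big_ord_recr /= IHp add_block_mx.
Qed.

End BlockSums.

Section Boundaries.
Variables (S : comUnitRingType) (k : fieldType) (res : {rmorphism S -> k}).
Variable f : nat -> S.
Hypothesis f_res : forall j, res (f j) = 0.
Variable c : nat.
Hypothesis f_reg : regular_upto f c.

Local Notation "A ~[ p ] B" := (eqmodI f p A B) (at level 70, no associativity).
Local Notation "A ^r" := (map_mx res A) (at level 2, format "A ^r").
Local Notation cocycle := (cocycle res).

(** The case distinction allows injectivity of an operator on cohomology to be stated in all degrees
    at once. *)
Definition coboundary (C : lcplx S) n : 'cV[k]_(lrk C n) -> Prop :=
  match n with
  | 0 => fun z => z = 0
  | n'.+1 => fun z => exists y, z = (ld C n')^r *m y
  end.

Lemma coboundary0 C n : coboundary (0 : 'cV_(lrk C n)).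
Proof. by case: n => //= n; exists 0; rewrite mulmx0. Qed.

Lemma coboundaryD C n (y z : 'cV_(lrk C n)) :
  coboundary y -> coboundary z -> coboundary (y + z).
Proof.
case: n y z => [|n] y z /= => [-> ->|[y' ->] [z' ->]]; first exact: addr0.
by exists (y' + z'); rewrite mulmxDr.
Qed.

Lemma coboundary_sum C n (I : Type) (r : seq I) (P : pred I)
    (z : I -> 'cV_(lrk C n)) :
  (forall i, P i -> coboundary (z i)) -> coboundary (\sum_(i <- r | P i) z i).
Proof.
by move=> Bz; apply: big_ind => //; [apply: coboundary0|apply: coboundaryD].
Qed.

Lemma coboundary_lop p (C : lcplx S) n j (y : 'cV_(lrk C n)) :
    resolves f p C -> (p <= c)%N -> (j < p)%N ->
  coboundary y -> coboundary ((lop C j n)^r *m y).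
Proof.
move=> rC pc jp; case: n y => [|n] y; first by move->; rewrite mulmx0; apply: coboundary0.
by move=> [x ->]; exists ((lop C j n)^r *m x); rewrite !mulmxA (lop_chain_res f_res f_reg _ rC).
Qed.

End Boundaries.

Section Cone.
Variables (S : comUnitRingType) (k : fieldType) (res : {rmorphism S -> k}).
Variable f : nat -> S.
Hypothesis f_res : forall j, res (f j) = 0.
Variable c : nat.
Hypothesis f_reg : regular_upto f c.

Local Notation "A ~[ p ] B" := (eqmodI f p A B) (at level 70, no associativity).
Local Notation "A ^r" := (map_mx res A) (at level 2, format "A ^r").
Local Notation cocycle := (cocycle res).
Local Notation coboundary := (coboundary res).

Lemma eqmodI_row p m n n' (A B : 'M[S]_(m, n)) (A' B' : 'M_(m, n')) :
  A ~[p] B -> A' ~[p] B' -> row_mx A A' ~[p] row_mx B B'.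
Proof.
move=> [u uE] [v vE]; exists (fun j => row_mx (u j) (v j)).
rewrite opp_row_mx add_row_mx uE vE.
under [RHS]eq_bigr do rewrite scale_row_mx.
by rewrite (sum_row_mx p (fun j => f j *: u j) (fun j => f j *: v j)).
Qed.

Lemma eqmodI_col p m m' n (A B : 'M[S]_(m, n)) (A' B' : 'M_(m', n)) :
  A ~[p] B -> A' ~[p] B' -> col_mx A A' ~[p] col_mx B B'.
Proof.
move=> [u uE] [v vE]; exists (fun j => col_mx (u j) (v j)).
rewrite opp_col_mx add_col_mx uE vE.
under [RHS]eq_bigr do rewrite scale_col_mx.
by rewrite (sum_col_mx p (fun j => f j *: u j) (fun j => f j *: v j)).
Qed.

(** Isolates the multiple of f_p, the relation that distinguishes the two rings; the multiplier [u]
    becomes an extra block in maps and lifts for the cone. *)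
Lemma eqmodI_succ p m n (A B : 'M[S]_(m, n)) :
  A ~[p.+1] B <-> exists u, A ~[p] B + f p *: u.
Proof.
rewrite /eqmodI in_idealS.
by split=> -[u uP]; exists u; move: uP; rewrite opprD addrA.
Qed.

Variables (p : nat) (C : lcplx S).
Hypotheses (pc : (p < c)%N) (rC : resolves f p.+1 C).

(** Sharper than [lop_chain], which works modulo f_p as well: f_p t_p is d d modulo the first p
    relations, so f_p times the commutator vanishes there and f_p can be cancelled. *)
Lemma lop_last_chain n : ld C n.+2 *m lop C p n ~[p] lop C p n.+1 *m ld C n.
Proof.
apply/eqmodI_sub0/(regular_mx f_reg pc).
have dd m : f p *: lop C p m ~[p] ld C m.+1 *m ld C m.
  symmetry; rewrite rC.1 big_ord_recr /= /eqmodI addrK.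
  exact: (in_ideal_sum f p (fun j => lop C j m)).
rewrite scalerBr scalemxAr scalemxAl !dd mulmxA subrr; reflexivity.
Qed.

Definition cone_v n : nat -> 'M_(lrk C n.+3, lrk C n) := sval (cid (lop_last_chain n)).

Lemma cone_vP n : ld C n.+2 *m lop C p n - lop C p n.+1 *m ld C n =
  \sum_(j < p) f j *: cone_v n j.
Proof. exact: (svalP (cid (lop_last_chain n))). Qed.

Definition cone_rk n : nat :=
  match n with 0 => lrk C 0 | n'.+1 => lrk C n'.+1 + lrk C n' end.

Definition cone_ld n : 'M_(cone_rk n.+1, cone_rk n) :=
  match n with
  | 0 => col_mx (ld C 0) (f p)%:M
  | n'.+1 => block_mx (ld C n'.+1) (- lop C p n') (f p)%:M (- ld C n')
  end.

Definition cone_lop (j n : nat) : 'M_(cone_rk n.+2, cone_rk n) :=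
  match n with
  | 0 => col_mx (lop C j 0) 0
  | n'.+1 => block_mx (lop C j n'.+1) (- cone_v n' j) 0 (lop C j n')
  end.

(* The cone of t_p : C -> C[-2] resolves the same module over the ring with one
   relation less; hence Ext over that ring is Ext / chi_p as soon as chi_p is
   injective. *)
Definition cone : lcplx S := LCplx cone_ld cone_lop.

(** The first block column of the cycle condition settles both blocks: [a] is a cycle modulo p+1
    relations, so it lifts up to a multiple f_p u, and after substitution f_p cancels to give
    [b]. *)
Lemma cone_exact n m (a : 'M_(m, lrk C n.+1)) (b : 'M_(m, lrk C n)) :
    a *m ld C n + f p *: b ~[p] 0 ->
  exists a' u, a ~[p] a' *m ld C n.+1 + f p *: u /\
               b ~[p] - (a' *m lop C p n) - u *m ld C n.
Proof.
move=> ab0.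
have [a'] : exists a', a ~[p.+1] a' *m ld C n.+1.
  apply: rC.2; apply/eqmodI_succ; exists (- b).
  by rewrite add0r scalerN; apply/eqmodI_sub0; rewrite opprK.
move=> /eqmodI_succ[u au]; exists a', u; split=> //.
apply/eqmodI_sub0/(regular_mx f_reg pc); rewrite -opprD opprK -ab0.
have dd : ld C n.+1 *m ld C n ~[p] f p *: lop C p n.
  rewrite rC.1 big_ord_recr /= /eqmodI addrK.
  exact: (in_ideal_sum f p (fun j => lop C j n)).
rewrite au mulmxDl -mulmxA dd -scalemxAl -scalemxAr [X in _ ~[p] X]addrC.
by rewrite !scalerDr; reflexivity.
Qed.

Lemma cone_resolves : resolves f p cone.
Proof.
split=> [[|n]|[|n] m x] /=.
- rewrite mul_block_col !rC.1 mulNmx mul_mx_scalar mul_scalar_mx.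
  rewrite mulNmx mul_mx_scalar subrr big_ord_recr /= addrK.
  under [RHS]eq_bigr do rewrite scale_col_mx scaler0.
  by rewrite (sum_col_mx p (fun j => f j *: lop C j 0) (fun=> 0)) big1_eq.
- rewrite mulmx_block !mulmxN !mulNmx !opprK !rC.1 !mul_mx_scalar !mul_scalar_mx.
  rewrite subrr [- (f p *: _) + _]addrC !big_ord_recr /= !addrK.
  under [RHS]eq_bigr do rewrite scale_block_mx scaler0 scalerN.
  rewrite (sum_block_mx p (fun j => f j *: lop C j n.+1) (fun j => - (f j *: cone_v n j))
             (fun=> 0) (fun j => f j *: lop C j n)) big1_eq sumrN -cone_vP opprB.
  by rewrite addrC.
- rewrite -[x]hsubmxK mul_row_col mul_mx_scalar => /cone_exact[a [u [lx rx]]].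
  exists (row_mx a u); rewrite mul_row_block mulmxN mulmxN mul_mx_scalar.
  exact: eqmodI_row.
- rewrite -[x]hsubmxK mul_row_block => x0.
  have : lsubmx x *m ld C n.+1 + f p *: rsubmx x ~[p] 0.
    have <- : row_mx (lsubmx x *m ld C n.+1 + rsubmx x *m (f p)%:M)
        (lsubmx x *m - lop C p n + rsubmx x *m - ld C n) *m col_mx 1%:M 0 =
      lsubmx x *m ld C n.+1 + f p *: rsubmx x.
      by rewrite mul_row_col mulmx1 mulmx0 addr0 mul_mx_scalar.
    by rewrite x0 mul0mx; reflexivity.
  move=> /cone_exact[a [u [lx rx]]].
  exists (row_mx a u); rewrite mul_row_block mulmxN mulmxN mul_mx_scalar.
  exact: eqmodI_row.
Qed.

(** Since h E = f_p, the cokernel of [E] is already killed by f_p over the ring with one relation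
    less. Errors that are multiples of f_p are absorbed through [h] on the side of [E] and through
    the block f_p of the differential on the side of the cone. *)
Lemma cone_retract n0 n1 (E : 'M[S]_(n1, n0)) (h : 'M_(n0, n1)) :
  h *m E ~[p] (f p)%:M -> retract f p.+1 (ld C 0) E -> retract f p (ld cone 0) E.
Proof.
move=> hE [a0 [b0 [a1 [b1 [s0 []]]]]].
move=> /eqmodI_succ[u uE] /eqmodI_succ[v vE] /eqmodI_succ[w wE].
exists a0, b0, (col_mx (a1 + u *m h) (a0 *m h)), (row_mx b1 v), (row_mx s0 w).
split=> /=.
- rewrite !mul_col_mx; apply: eqmodI_col; rewrite ?mulmxDl -mulmxA hE.
    by rewrite mul_mx_scalar.
  by rewrite mul_mx_scalar mul_scalar_mx; reflexivity.
- by rewrite mul_row_col mul_mx_scalar.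
- by rewrite mul_row_col mul_mx_scalar addrA.
Qed.

(** On cohomology, the change of rings map from Ext over p+1 relations to Ext over p relations. *)
Definition cone_in n : 'cV[k]_(lrk C n) -> 'cV[k]_(lrk cone n) :=
  match n with
  | 0 => id
  | n'.+1 => fun z => col_mx z 0
  end.

Lemma cone_ldE n (z : 'cV_(lrk C n.+1)) (y : 'cV_(lrk C n)) :
  (ld cone n.+1)^r *m col_mx z y =
  col_mx ((ld C n.+1)^r *m z - (lop C p n)^r *m y) (- ((ld C n)^r *m y)).
Proof.
rewrite /= map_block_mx mul_block_col map_scalar_mx f_res !map_mxN !mulNmx.
by rewrite mul_scalar_mx scale0r add0r.
Qed.

Lemma cone_ld0 (z : 'cV_(lrk C 0)) : (ld cone 0)^r *m z = col_mx ((ld C 0)^r *m z) 0.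
Proof.
by rewrite /= map_col_mx mul_col_mx map_scalar_mx f_res mul_scalar_mx scale0r.
Qed.

(** The long exact sequence of the cone in coordinates: the second block of a cocycle is a class
    annihilated by [chi_p]. *)
Lemma cone_cocycle_col n (z : 'cV_(lrk C n.+1)) (y : 'cV_(lrk C n)) :
  cocycle (col_mx z y : 'cV_(lrk cone n.+1)) <->
  (lop C p n)^r *m y = (ld C n.+1)^r *m z /\ cocycle y.
Proof.
rewrite /cocycle cone_ldE; split=> [zy0|[-> ->]]; last by rewrite subrr oppr0 col_mx0.
have /eqP : col_mx ((ld C n.+1)^r *m z - (lop C p n)^r *m y) (- ((ld C n)^r *m y)) = 0.
  exact: zy0.
by rewrite col_mx_eq0 subr_eq0 oppr_eq0 => /andP[/eqP -> /eqP ->].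
Qed.

Lemma cone_in_cocycle n (z : 'cV_(lrk C n)) : cocycle z -> cocycle (cone_in z).
Proof.
rewrite /cocycle; case: n z => [|n] z Zz; first by rewrite cone_ld0 Zz col_mx0.
by apply/cone_cocycle_col; rewrite Zz /cocycle !mulmx0.
Qed.

Lemma cone_lop_in j n (z : 'cV_(lrk C n)) :
  (lop cone j n)^r *m cone_in z = cone_in ((lop C j n)^r *m z).
Proof.
case: n z => [|n] z /=.
  by rewrite map_col_mx mul_col_mx map_mx0 mul0mx.
by rewrite map_block_mx mul_block_col map_mx0 mul0mx !mulmx0 !addr0.
Qed.

Hypothesis cone_gen : gen_step res p cone.
Hypothesis chi_inj0 : forall (y : 'cV_(lrk C 0)) z,
  cocycle y -> (lop C p 0)^r *m y = (ld C 1)^r *m z -> y = 0.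

(* chi_p is injective on Ext^n iff the map from Ext^(n+1) over the ring with all
   relations to Ext^(n+1) over the one with one relation less is onto; as the
   latter is generated in degrees 0 and 1, the case n = 0 suffices. *)
Lemma chi_inj n (y : 'cV_(lrk C n)) z :
  cocycle y -> (lop C p n)^r *m y = (ld C n.+1)^r *m z -> coboundary y.
Proof.
have [m] := ubnP n; elim: m => // m IHm in n y z *; rewrite ltnS => nm Zy tyz.
case: n y z => [|n] y z in nm Zy tyz *; first exact: (chi_inj0 Zy tyz).
(* A class killed by [chi_p] is completed by [z] to a cocycle of the cone, one degree higher, to
   which generation applies. *)
have Zzy : cocycle (col_mx z y : 'cV_(lrk cone n.+2)).
  by apply/cone_cocycle_col.
have [w [x [Zw /(congr1 (mulmx (row_mx 0 1%:M)))]]] := cone_gen Zzy.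
rewrite -[x]vsubmxK cone_ldE mulmxDr !mul_row_col !mul0mx !add0r !mul1mx mulmx_sumr.
(* For [y] in degree 1 the coefficients lie in degree 0 of the cone, which has no second block. *)
case: n => [|n] in y z nm Zy tyz Zzy w x Zw * => ->.
  rewrite big1 ?add0r => [|j _]; last first.
    by rewrite /= map_col_mx mul_col_mx mul_row_col mul0mx add0r map_mx0 mul0mx mulmx0.
  by exists (- dsubmx x); rewrite mulmxN.
apply: coboundaryD; last by exists (- dsubmx x); rewrite mulmxN.
apply: coboundary_sum => j _.
(* The second blocks of the coefficients are again killed by [chi_p], two degrees below [y]. *)
have := Zw j; rewrite -[w j]vsubmxK => /cone_cocycle_col[tDz Zwj].
rewrite /= map_block_mx mul_block_col mul_row_col mul0mx mul1mx map_mx0 mul0mx !add0r.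
apply: (coboundary_lop f_res f_reg rC) => //; first exact: ltnW (ltn_ord j).
apply: (IHm n) Zwj tDz.
by rewrite -ltnS ltnW.
Qed.

(** Surjectivity of the change of rings map: a second block is killed by [chi_p], hence a coboundary
    dx (or zero, in degree 0), and the coboundary of (0, -x) removes it. *)
Lemma cone_cocycle_rep n (w : 'cV_(lrk cone n)) : cocycle w ->
  exists z, cocycle z /\ coboundary (w - cone_in z).
Proof.
case: n w => [|n] w Zw.
  exists w; split; last by rewrite /= subrr.
  have /eqP : col_mx ((ld C 0)^r *m w) (0 : 'cV_(lrk C 0)) = 0.
    by exact: etrans (esym (cone_ld0 w)) Zw.
  by rewrite col_mx_eq0 => /andP[/eqP].
have := Zw; rewrite -[w]vsubmxK => /cone_cocycle_col[Dz Dy].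
have := chi_inj Dy Dz; case: n w {Zw} Dz Dy => [|n] w Dz Dy.
  move=> /= w0; exists (usubmx w); split; first by rewrite /cocycle -Dz w0 mulmx0.
  by rewrite w0 subrr; apply: (@coboundary0 _ _ res cone 1).
move=> /= [x xE]; exists (usubmx w - (lop C p n)^r *m x); split.
  rewrite /cocycle mulmxBr -Dz xE !mulmxA (lop_chain_res f_res f_reg _ rC) //.
  by rewrite subrr.
exists (col_mx 0 (- x)); have /= -> := cone_ldE 0 (- x).
by rewrite xE opp_col_mx add_col_mx mulmx0 sub0r !mulmxN !opprK subr0 opprB addrC subrK.
Qed.

Lemma cone_inB n (x y : 'cV_(lrk C n)) : cone_in (x - y) = cone_in x - cone_in y.
Proof. by case: n x y => //= n x y; rewrite opp_col_mx add_col_mx subr0. Qed.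

Lemma cone_in_sum n (I : Type) (r : seq I) (P : pred I) (x : I -> 'cV_(lrk C n)) :
  cone_in (\sum_(i <- r | P i) x i) = \sum_(i <- r | P i) cone_in (x i).
Proof.
have in0 : cone_in (0 : 'cV_(lrk C n)) = 0.
  by rewrite -[X in cone_in X](subrr 0) cone_inB subrr.
apply: (big_morph (@cone_in n)) => // y z.
by rewrite -[z in LHS]opprK cone_inB -[- z]sub0r cone_inB in0 sub0r opprK.
Qed.

(** Exactness in the middle: the kernel of the change of rings map consists of the multiples of
    [chi_p]. *)
Lemma cone_in_coboundary n (x : 'cV_(lrk C n.+2)) : coboundary (cone_in x) ->
  exists u y, cocycle u /\ x = (lop C p n)^r *m u + (ld C n.+1)^r *m y.
Proof.
move=> [y]; rewrite -[y]vsubmxK cone_ldE => /eq_col_mx[-> /esym/eqP].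
rewrite oppr_eq0 => /eqP Dy; exists (- dsubmx y), (usubmx y).
by rewrite /cocycle !mulmxN Dy oppr0 addrC.
Qed.

Lemma cone_cocycle_reps n (w : nat -> 'cV_(lrk cone n)) : (forall j, cocycle (w j)) ->
  exists w' : nat -> 'cV_(lrk C n),
    (forall j, cocycle (w' j)) /\ forall j, coboundary (w j - cone_in (w' j)).
Proof.
move=> Zw; exists (fun j => sval (cid (cone_cocycle_rep (Zw j)))).
by split=> j; have [] := svalP (cid (cone_cocycle_rep (Zw j))).
Qed.

(** Lifts an expression from Ext modulo [chi_p] to Ext. The coefficients lift by surjectivity; the
    discrepancy is a multiple of [chi_p] and supplies the term j = p. *)
Lemma cone_combination n q (w : nat -> 'cV_(lrk cone n)) (z : 'cV_(lrk C n.+2)) :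
    (q <= p)%N -> (forall j, cocycle (w j)) ->
    coboundary (cone_in z - \sum_(q <= j < p) (lop cone j n)^r *m w j) ->
  exists (w' : nat -> 'cV_(lrk C n)) y, (forall j, cocycle (w' j)) /\
    z = \sum_(q <= j < p.+1) (lop C j n)^r *m w' j + (ld C n.+1)^r *m y.
Proof.
move=> qp /cone_cocycle_reps[w' [Zw' Bw']] Bz.
have : coboundary (cone_in (z - \sum_(q <= j < p) (lop C j n)^r *m w' j)).
  rewrite cone_inB cone_in_sum.
  have -> : \sum_(q <= j < p) cone_in ((lop C j n)^r *m w' j) =
      \sum_(q <= j < p) (lop cone j n)^r *m w j -
      \sum_(q <= j < p) (lop cone j n)^r *m (w j - cone_in (w' j)).
    rewrite -sumrB; apply: eq_bigr => j _.
    by rewrite mulmxBr opprB addrC subrK cone_lop_in.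
  rewrite opprD opprK addrA; apply: coboundaryD => //.
  rewrite big_nat; apply: coboundary_sum => j /andP[_ jp].
  by apply: (coboundary_lop f_res f_reg cone_resolves) => //; apply: ltnW.
move=> /cone_in_coboundary[u [y [Zu zE]]].
exists (fun j => if j == p then u else w' j), y; split=> [j|]; first by case: eqP.
rewrite big_nat_recr //= eqxx -addrA -zE addrC.
rewrite -[LHS](subrK (\sum_(q <= j < p) (lop C j n)^r *m w' j)).
congr (_ + _); rewrite [LHS]big_nat [RHS]big_nat; apply: eq_bigr => j /andP[_ jp].
by rewrite ltn_eqF.
Qed.

Lemma cone_gen_step : gen_step res p.+1 C.
Proof.
move=> n z Zz; have [w [x [Zw zE]]] := cone_gen (cone_in_cocycle Zz).
have Bz : coboundary (cone_in z - \sum_(0 <= j < p) (lop cone j n)^r *m w j).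
  by rewrite zE big_mkord addrAC subrr add0r; exists x.
have [w' [y [Zw' ->]]] := cone_combination (leq0n p) Zw Bz.
by exists w', y; rewrite big_mkord.
Qed.

Lemma cone_rel_step : rel_step res p cone -> rel_step res p.+1 C.
Proof.
move=> cone_rel n q z qp Zz [y yE].
move: qp; rewrite ltnS leq_eqVlt => /predU1P[qp|qp].
  move: yE; rewrite qp big_nat1 => /(chi_inj (Zz p))[x ->].
  exists (fun=> 0), x; rewrite big_geq // add0r; split=> // j.
  by rewrite /cocycle mulmx0.
have [||w [x [Zw zE]]] := cone_rel n q (fun j => cone_in (z j)) qp.
- by move=> j; apply: cone_in_cocycle.
(* The second block [z p] contributes -t_p (z p) to the coboundary, which deletes the term j = p of
   the relation. *)
- exists (col_mx y (z p)); rewrite cone_ldE Zz oppr0 -yE big_nat_recr ?(ltnW qp) //=.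
  rewrite addrK -[col_mx _ _]/(cone_in (_ : 'cV_(lrk C n.+4))) cone_in_sum.
  by apply: eq_bigr => j _; rewrite cone_lop_in.
apply: cone_combination Zw _ => //.
by rewrite zE addrAC subrr add0r; exists x.
Qed.

End Cone.

(** * The box complex *)

Section Box.
Variables (S : comUnitRingType) (k : fieldType) (res : {rmorphism S -> k}).
Variable f : nat -> S.
Hypothesis f_res : forall j, res (f j) = 0.
Variable c : nat.
Hypothesis f_reg : regular_upto f c.

Local Notation "A ~[ p ] B" := (eqmodI f p A B) (at level 70, no associativity).
Local Notation "A ^r" := (map_mx res A) (at level 2, format "A ^r").
Local Notation cocycle := (cocycle res).

Variables (p : nat) (C : lcplx S).
Hypotheses (pc : (p < c)%N) (rC : resolves f p C).
Variables (n0 n1 : nat) (E : 'M[S]_(n1, n0)) (h : 'M[S]_(n0, n1)).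
Variables (J0 : 'M[S]_(lrk C 0, n0)) (J1 : 'M[S]_(lrk C 1, n1)).
Variables (K0 : 'M[S]_(n0, lrk C 0)) (K1 : 'M[S]_(n1, lrk C 1)).
Hypotheses (JK0 : J0 *m K0 = 1%:M) (JK1 : J1 *m K1 = 1%:M).
Hypothesis JE : J1 *m E = ld C 0 *m J0.
Hypothesis Eh : exists U, E *m h ~[p] (f p)%:M + U *m J1.

(* Replacing A_s(p) by A_s(p+1) in degrees 0 and 1 turns a resolution of M(p)
   over S / (f_0, ..., f_{p-1}) into one of M(p+1) over the same ring: the
   congruence for E *m h says that the first syzygies of M(p+1) already lie in
   A_1(p). *)
Definition box_rk n : nat :=
  match n with 0 => n0 | 1 => n1 | m.+2 => lrk C m.+2 end.

Definition box_ld n : 'M_(box_rk n.+1, box_rk n) :=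
  match n with
  | 0 => E
  | 1 => ld C 1 *m J1
  | m.+2 => ld C m.+2
  end.

Definition box_lop (j n : nat) : 'M_(box_rk n.+2, box_rk n) :=
  match n with
  | 0 => lop C j 0 *m J0
  | 1 => lop C j 1 *m J1
  | m.+2 => lop C j m.+2
  end.

Definition box : lcplx S := LCplx box_ld box_lop.

Lemma box_resolves : resolves f p box.
Proof.
split=> [[|[|n]]|[|[|n]] m x] /=; rewrite ?rC.1 //.
- rewrite -mulmxA JE mulmxA rC.1 mulmx_suml.
  by apply: eq_bigr => j _; rewrite scalemxAl.
- by rewrite mulmxA rC.1 mulmx_suml; apply: eq_bigr => j _; rewrite scalemxAl.
- move=> xE; have [U EhU] := Eh.
  (* Modulo the ideal, f_p x lies in the previous stage by the congruence for E h; as that stage is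
     a summand and f_p is regular, so does x. *)
  have x1 : x ~[p] x *m K1 *m J1.
    apply/eqmodI_sub0/(regular_mx f_reg pc).
    have fx : f p *: x ~[p] - (x *m U *m J1).
      apply/eqmodI_sub0; rewrite opprK -mulmxA -mul_mx_scalar -mulmxDr -EhU mulmxA xE.
      by rewrite mul0mx; reflexivity.
    rewrite scalerBr !scalemxAl fx mulNmx -(mulmxA _ J1) JK1 mulmx1 mulNmx subrr.
    by reflexivity.
  have [a xa] : exists a, x *m K1 ~[p] a *m ld C 1.
    apply: rC.2; rewrite -[_ *m ld C 0]mulmx1 -JK0 mulmxA -(mulmxA _ _ J0) -JE !mulmxA.
    by rewrite -x1 xE mul0mx; reflexivity.
  by exists a; rewrite mulmxA -xa.
- move=> xJ; apply: rC.2; rewrite -[_ *m ld C 1]mulmx1 -JK1 !mulmxA -(mulmxA x) xJ mul0mx.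
  by reflexivity.
- exact: rC.2.
Qed.

Hypothesis E_min : E^r = 0.

Lemma box_lift0 (z : 'cV[k]_(lrk C 0)) : J0^r *m (K0^r *m z) = z.
Proof. by rewrite mulmxA -map_mxM JK0 map_mx1 mul1mx. Qed.

Lemma box_lift1 (z : 'cV[k]_(lrk C 1)) : J1^r *m (K1^r *m z) = z.
Proof. by rewrite mulmxA -map_mxM JK1 map_mx1 mul1mx. Qed.

(** Cocycles of [C] lift along [K0] and [K1]. In degree 0 the lift is a cocycle because [E] is
    minimal, in degree 1 because the next differential factors through [J1]. *)
Lemma box_gen_step : gen_step res p C -> gen_step res p box.
Proof.
move=> genC [|[|n]] z Zz; have [w [y [Zw ->]]] := genC _ z Zz; last by exists w, y.
- exists (fun j => K0^r *m w j), (K1^r *m y); split=> [j|/=].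
    by rewrite /cocycle /= E_min mul0mx.
  rewrite map_mxM -(mulmxA _ J1^r) box_lift1; congr (_ + _).
  by apply: eq_bigr => j _; rewrite map_mxM -(mulmxA _ J0^r) box_lift0.
- exists (fun j => K1^r *m w j), y; split=> [j|/=].
    by rewrite /cocycle /= map_mxM -(mulmxA _ J1^r) box_lift1; apply: Zw.
  congr (_ + _).
  by apply: eq_bigr => j _; rewrite map_mxM -(mulmxA _ J1^r) box_lift1.
Qed.

(** The given relation lives in degrees at least 2, where the box agrees with [C]; only the
    coefficients in the conclusion have to be lifted. *)
Lemma box_rel_step : rel_step res p C -> rel_step res p box.
Proof.
move=> relC [|[|n]] q z qp Zz yE; have [w [y [Zw E']]] := relC _ q z qp Zz yE;
  last by exists w, y.
- exists (fun j => K0^r *m w j), (K1^r *m y); split=> [j|/=].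
    by rewrite /cocycle /= E_min mul0mx.
  rewrite E' map_mxM -(mulmxA _ J1^r) box_lift1; congr (_ + _).
  by apply: eq_bigr => j _; rewrite map_mxM -(mulmxA _ J0^r) box_lift0.
- exists (fun j => K1^r *m w j), y; split=> [j|/=].
    by rewrite /cocycle /= map_mxM -(mulmxA _ J1^r) box_lift1; apply: Zw.
  rewrite E'; congr (_ + _).
  by apply: eq_bigr => j _; rewrite map_mxM -(mulmxA _ J1^r) box_lift1.
Qed.

End Box.

(** * Injectivity of the newest operator in degree 0 *)

Section Base.
Variables (S : comUnitRingType) (k : fieldType) (res : {rmorphism S -> k}).
Variable f : nat -> S.
Hypothesis f_res : forall j, res (f j) = 0.
Variable c : nat.
Hypothesis f_reg : regular_upto f c.

Local Notation "A ~[ p ] B" := (eqmodI f p A B) (at level 70, no associativity).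
Local Notation "A ^r" := (map_mx res A) (at level 2, format "A ^r").
Local Notation cocycle := (cocycle res).

(* Over the first p relations as well as over the first p+1 ones, E presents the
   module, minimally because h is; this is the injectivity of chi_p on Ext^0. *)
Lemma chi_inj_retract p (C : lcplx S) n0 n1 (E : 'M[S]_(n1, n0)) (h : 'M_(n0, n1)) :
    (p < c)%N -> resolves f p.+1 C -> retract f p.+1 (ld C 0) E ->
    h *m E ~[p] (f p)%:M -> h^r = 0 ->
  forall (y : 'cV_(lrk C 0)) z, cocycle y ->
    (lop C p 0)^r *m y = (ld C 1)^r *m z -> y = 0.
Proof.
move=> pc rC [a0 [b0 [a1 [b1 [s0 [_ Eb ab]]]]]] hE h0 y z Dy tyz.
have [g bg] := (eqmodI_succ f p _ _).1 Eb.
(* Modulo the first p relations, h b1 d = f_p (b0 - h g); so h b1 is a cycle modulo p+1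
   relations. *)
have [e he] : exists e, h *m b1 ~[p.+1] e *m ld C 1.
  apply: rC.2; rewrite -mulmxA; apply/eqmodI_succ; exists (b0 - h *m g).
  rewrite add0r scalerBr scalemxAr -[f p *: b0]mul_scalar_mx -hE -mulmxA bg mulmxDr addrK.
  by reflexivity.
have [u hu] := (eqmodI_succ f p _ _).1 he.
(* Cancelling f_p writes [b0] as three terms that all annihilate [y] after reduction: the first by
   [tyz] and the minimality of [h], the second because [y] is a cocycle, the third by the minimality
   of [h]. *)
have b0E : b0 ~[p] e *m lop C p 0 + u *m ld C 0 + h *m g.
  apply/eqmodI_sub0/(regular_mx f_reg pc).
  have dd : ld C 1 *m ld C 0 ~[p] f p *: lop C p 0.
    rewrite rC.1 big_ord_recr /= /eqmodI addrK.
    exact: (in_ideal_sum f p (fun j => lop C j 0)).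
  rewrite scalerBr -[f p *: b0]mul_scalar_mx -hE -mulmxA bg mulmxDr.
  rewrite [h *m (b1 *m _)]mulmxA hu mulmxDl -mulmxA dd.
  by rewrite -scalemxAl -!scalemxAr -!scalerDr subrr; reflexivity.
have b0y : b0^r *m y = 0.
  rewrite (res_eqmodI f_res b0E) !map_mxD !map_mxM h0 mul0mx addr0 mulmxDl -!mulmxA.
  rewrite Dy mulmx0 addr0 tyz mulmxA -map_mxM -(res_eqmodI f_res he) map_mxM h0.
  by rewrite !mul0mx.
have /(congr1 (mulmxr y)) := res_eqmodI f_res ab.
rewrite /= map_mxD !map_mxM map_mx1 mulmxDl mul1mx -!mulmxA Dy mulmx0 addr0 b0y.
by rewrite mulmx0.
Qed.

End Base.

(** * Existence of resolutions *)

Section Noetherian.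
Variable S : comUnitRingType.
Hypothesis S_noeth : noetherian S.

(** Induction on n: lifts of generators of the ideal of first coordinates, together with generators
    of the part with first coordinate 0. *)
Lemma noetherian_submod n (U : 'rV[S]_n -> Prop) : is_submod U ->
  exists m (K : 'M[S]_(m, n)), forall x, U x <-> exists a : 'rV_m, x = a *m K.
Proof.
elim: n U => [|n IHn]; rewrite -?[n.+1]/(1 + n)%N => U [U0 UD UZ].
  exists 0%N, 0 => x; rewrite [x]thinmx0; split=> // _.
  by exists 0; rewrite mul0mx.
have [|m [g gP]] := S_noeth (J := fun s => exists x : 'rV_n, U (row_mx (s%:M : 'M_1) x)).
- split=> [|s t [x Ux] [y Uy]|s t [x Ux]].
  + by exists 0; rewrite raddf0 row_mx0.
  + by exists (x + y); rewrite raddfD -add_row_mx; apply: UD.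
  + by exists (s *: x); rewrite -scale_scalar_mx -scale_row_mx; apply: UZ.
have gJ i : exists x : 'rV_n, U (row_mx ((g i)%:M : 'M_1) x).
  apply/gP; exists (fun j => (j == i)%:R).
  by rewrite (bigD1 i) //= eqxx mul1r big1 ?addr0 // => j /negPf->; rewrite mul0r.
have [y yP] := choice gJ.
have Usum (r : 'rV_m) : U (\sum_i r 0 i *: row_mx ((g i)%:M : 'M_1) (y i)).
  by elim/big_ind: _ => // i _; apply: UZ.
have [|l [K KP]] := IHn (fun x => U (row_mx (0 : 'M_1) x)).
  split=> [|x x' Ux Ux'|s x Ux]; first by rewrite row_mx0.
    by rewrite -[X in row_mx X _]addr0 -add_row_mx; apply: UD.
  by rewrite -[X in row_mx X _](scaler0 _ s) -scale_row_mx; apply: UZ.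
pose Y := \matrix_(i < m) row_mx ((g i)%:M : 'M_1) (y i).
have YE (r : 'rV_m) : r *m Y = \sum_i r 0 i *: row_mx ((g i)%:M : 'M_1) (y i).
  by rewrite mulmx_sum_row; apply: eq_bigr => i _; rewrite rowK.
exists (m + l)%N, (col_mx Y (row_mx 0 K)) => x; split=> [Ux|[a ->]]; last first.
  rewrite -[a]hsubmxK mul_row_col YE mul_mx_row mulmx0; apply: UD => //.
  by apply/KP; exists (rsubmx a).
have [a aE] : exists a : 'I_m -> S, x 0 0 = \sum_i a i * g i.
  apply/gP; exists (rsubmx (x : 'rV_(1 + n))).
  suff <- : x = row_mx (x 0 0)%:M (rsubmx (x : 'rV_(1 + n))) by [].
  rewrite -[LHS](@hsubmxK _ 1 1 n); congr row_mx; rewrite [LHS]mx11_scalar mxE.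
  by congr ((x 0 _)%:M); apply: val_inj.
pose r : 'rV_m := \row_i a i.
have lx : lsubmx (x - r *m Y : 'rV_(1 + n)) = 0.
  rewrite [LHS]mx11_scalar !mxE (_ : lshift n 0 = 0) ?aE; last exact: val_inj.
  rewrite (_ : \sum_j _ = \sum_i a i * g i) ?subrr ?raddf0 //.
  apply: eq_bigr => i _; rewrite !mxE; case: splitP => j // j0.
  by rewrite mxE ord1 eqxx mulr1n.
have [b bE] : exists b : 'rV_l, rsubmx (x - r *m Y : 'rV_(1 + n)) = b *m K.
  apply/KP; rewrite -lx hsubmxK; apply: UD => //.
  by rewrite -scaleN1r; apply: UZ; rewrite YE.
exists (row_mx r b); rewrite mul_row_col mul_mx_row mulmx0 -bE -lx hsubmxK.
by rewrite addrC subrK.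
Qed.

Variables (f : nat -> S) (p : nat).

Local Notation "A ~[ p ] B" := (eqmodI f p A B) (at level 70, no associativity).

Lemma syzygies_ex m n (E : 'M[S]_(m, n)) :
  exists l (K : 'M[S]_(l, m)), K *m E ~[p] 0 /\
    forall l' (x : 'M_(l', m)), x *m E ~[p] 0 -> exists y, x ~[p] y *m K.
Proof.
have [|l [K KP]] := @noetherian_submod m (fun x => x *m E ~[p] 0).
  split=> [|x y xE yE|s x xE]; rewrite ?mul0mx ?mulmxDl -?scalemxAl ?xE ?yE;
    by rewrite ?scaler0 ?addr0; reflexivity.
exists l, K; split=> [|l' x xE].
  apply/eqmodI0/in_ideal_entries => i j.
  have /eqmodI0[u uE] : row i (K *m E) ~[p] 0.
    by rewrite row_mul; apply: (KP _).2; exists (delta_mx 0 i); exact: rowE.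
  exists (fun l' => (u l' 0 j)%:M).
  have -> : (K *m E) i j = (row i (K *m E)) 0 j by rewrite [RHS]mxE.
  by rewrite uE summxE raddf_sum; apply: eq_bigr => l' _; rewrite mxE scale_scalar_mx.
have /fin_all_exists[y yP] i : exists a : 'rV_l, row i x = a *m K.
  by apply: (KP _).1; rewrite -row_mul rowE xE mulmx0; reflexivity.
exists (\matrix_i y i); suff <- : x = \matrix_i y i *m K by reflexivity.
by apply/row_matrixP => i; rewrite row_mul rowK.
Qed.

(** The ranks in degrees 0 and 1 compute to [n0] and [n1], so that a given matrix can be the first
    differential without a cast. *)
Definition from_rk n0 n1 (r : nat -> nat) n : nat :=
  match n with 0 => n0 | 1 => n1 | m.+2 => r m end.

Lemma resolution_ex n0 n1 (E : 'M[S]_(n1, n0)) :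
  exists r (D : forall i, 'M_(from_rk n0 n1 r i.+1, from_rk n0 n1 r i)) t,
    D 0%N = E /\ resolves f p (LCplx D t).
Proof.
pose T := {x : nat * nat & 'M[S]_(x.1, x.2)}.
have step (x : T) : {l & {K : 'M[S]_(l, (tag x).1) | K *m tagged x ~[p] 0 /\
    forall l' (y : 'M_(l', (tag x).1)), y *m tagged x ~[p] 0 -> exists a, y ~[p] a *m K}}.
  by have /cid[l /cid[K KP]] := syzygies_ex (tagged x); exists l, K.
pose mk (i : nat * nat) (K : 'M[S]_(i.1, i.2)) : T := Tagged (fun x => 'M[S]_(x.1, x.2)) K.
pose next x : T := mk (tag (step x), (tag x).1) (sval (tagged (step x))).
pose g := fix g n : T := if n is n'.+1 then next (g n') else mk (n1, n0) E.
pose r n := (tag (g n.+1)).1.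
pose D i : 'M_(from_rk n0 n1 r i.+1, from_rk n0 n1 r i) :=
  match i with 0 => E | 1 => tagged (g 1%N) | m.+2 => tagged (g m.+2) end.
have DP i : D i.+1 *m D i ~[p] 0 /\ forall l' (y : 'M_(l', _)), y *m D i ~[p] 0 ->
    exists a, y ~[p] a *m D i.+1.
  case: i => [|[|i]]; first exact: (svalP (tagged (step (g 0%N)))).
    exact: (svalP (tagged (step (g 1%N)))).
  exact: (svalP (tagged (step (g i.+2)))).
pose t j i := sval (cid ((eqmodI0 f p _).1 (DP i).1)) j.
exists r, D, t; split=> //; split=> [i|i m x]; last exact: (DP i).2.
exact: (svalP (cid ((eqmodI0 f p _).1 (DP i).1))).
Qed.

End Noetherian.

(** * Higher matrix factorizations *)

Section Bases.
Variable S : comUnitRingType.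

Lemma row_subZ m n (A B : 'M[S]_(m, n)) s i :
  row i (A - s *: B) = row i A - s *: row i B.
Proof. by apply/rowP => j; rewrite !mxE. Qed.

Definition is_basis n (U : 'rV[S]_n -> Prop) r (b : 'M[S]_(r, n)) : Prop :=
  (forall x, U x <-> exists a : 'rV_r, x = a *m b) /\
  (forall a a' : 'rV_r, a *m b = a' *m b -> a = a').

Lemma basis_coords n (U : 'rV[S]_n -> Prop) r (b : 'M_(r, n)) m (Y : 'M_(m, n)) :
  is_basis U b -> (forall i, U (row i Y)) -> exists W, Y = W *m b.
Proof.
move=> [bP _] UY; have /fin_all_exists[w wE] i : exists a : 'rV_r, row i Y = a *m b.
  by apply/bP.
by exists (\matrix_i w i); apply/row_matrixP => i; rewrite row_mul rowK.
Qed.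

Lemma basis_mem n (U : 'rV[S]_n -> Prop) r (b : 'M_(r, n)) (a : 'rV_r) :
  is_basis U b -> U (a *m b).
Proof. by move=> [bP _]; apply/bP; exists a. Qed.

Lemma basis_row n (U : 'rV[S]_n -> Prop) r (b : 'M_(r, n)) i :
  is_basis U b -> U (row i b).
Proof. by move=> bU; rewrite rowE; apply: basis_mem bU. Qed.

Lemma basis_inj n (U : 'rV[S]_n -> Prop) r (b : 'M_(r, n)) m (W W' : 'M_(m, r)) :
  is_basis U b -> W *m b = W' *m b -> W = W'.
Proof.
move=> [_ b_inj] WW; apply/row_matrixP => i; apply: b_inj.
by rewrite -!row_mul WW.
Qed.

Lemma submod_comb n (U : 'rV[S]_n -> Prop) m (W : 'rV[S]_m) (Y : 'M_(m, n)) :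
  is_submod U -> (forall i, U (row i Y)) -> U (W *m Y).
Proof.
move=> [U0 UD UZ] UY; rewrite mulmx_sum_row.
by elim/big_ind: _ => // i _; apply: UZ.
Qed.

(** [W] is the projection of U' onto U along the complement, in coordinates. With b = J b', the rows
    of J Z lie both in U and in the complement, so they vanish and J W = 1. *)
Lemma summand_right_inverse n (U U' : 'rV[S]_n -> Prop) r r'
    (b : 'M_(r, n)) (b' : 'M_(r', n)) (q' : 'M_(n, r')) :
  is_basis U b -> is_basis U' b' -> direct_summand U U' -> b' *m q' = 1%:M ->
  exists q : 'M_(n, r), b *m q = 1%:M.
Proof.
move=> bU bU' [C [Csub U'E UC]] bq'.
have [J bE] : exists J, b = J *m b'.
  apply: basis_coords bU' _ => i; apply/U'E; exists (row i b), 0.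
  by rewrite addr0; split=> //; [apply: basis_row bU | case: Csub].
have split_row i : exists yz : 'rV[S]_n * 'rV[S]_n,
    [/\ U yz.1, C yz.2 & row i b' = yz.1 + yz.2].
  by have /U'E[y [z ?]] := basis_row i bU'; exists (y, z).
have /fin_all_exists[yz yzP] := split_row.
have [|W WE] := @basis_coords _ _ _ _ _ (\matrix_i (yz i).1) bU.
  by move=> i; rewrite rowK; have [] := yzP i.
pose Z := \matrix_i (yz i).2.
have b'E : b' = W *m b + Z.
  apply/matrixP => i j; rewrite -WE !mxE; have [_ _ /rowP/(_ j)] := yzP i.
  by rewrite !mxE.
have JZ : J *m Z = 0.
  apply/row_matrixP => i; rewrite row0 row_mul; apply: UC; last first.
    by apply: submod_comb => // j; rewrite rowK; have [] := yzP j.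
  have -> : row i J *m Z = (row i 1%:M - row i J *m W) *m b.
    rewrite mulmxBl -[row i 1%:M *m b]row_mul mul1mx bE row_mul -[in RHS]bE.
    by rewrite [in RHS]b'E mulmxDr mulmxA addrC addKr.
  exact: basis_mem bU.
have bq : b *m q' = J by rewrite bE -mulmxA bq' mulmx1.
exists (q' *m W); apply: (basis_inj bU); rewrite mul1mx mulmxA bq -mulmxA.
by rewrite -[W *m b](addrK Z) -b'E mulmxBr JZ subr0 -bE.
Qed.

End Bases.

Section Setting.
Variables (S : comUnitRingType) (k : fieldType) (R : comNzRingType) (c : nat).
Variable X : ci_setting S k R c.

Definition fnat (j : nat) : S := oapp (fseq X) 0 (insub j).

Lemma fnatE (i : 'I_c) : fnat i = fseq X i.
Proof. by rewrite /fnat valK. Qed.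

Lemma fnat_res j : res X (fnat j) = 0.
Proof.
by rewrite /fnat; case: insub => [i|] /=; rewrite ?rmorph0 // ci_fseq_max.
Qed.

Lemma sum_fnat (V : nmodType) p (F : nat -> V) : (p <= c)%N ->
  \sum_(j < p) F j = \sum_(i < c | (i < p)%N) F i.
Proof. by move=> pc; rewrite (big_ord_widen c). Qed.

Definition onat (T : Type) (t0 : T) (t : 'I_c -> T) (j : nat) : T := oapp t t0 (insub j).

Lemma onatE (T : Type) (t0 : T) (t : 'I_c -> T) (i : 'I_c) : onat t0 t i = t i.
Proof. by rewrite /onat valK. Qed.

Lemma span_in_ideal p s : (p <= c)%N ->
  span_lt (fseq X) p s <-> in_ideal fnat p (s%:M : 'M_1).
Proof.
move=> pc; split=> [[a ->]|[u uE]].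
  exists (fun j => (onat 0 a j)%:M).
  rewrite (sum_fnat (fun j => fnat j *: (onat 0 a j)%:M) pc) raddf_sum.
  by apply: eq_bigr => i _; rewrite onatE fnatE scale_scalar_mx mulrC.
exists (fun i => u i 0 0); have := congr1 (fun A : 'M_1 => A 0 0) uE.
rewrite mxE eqxx mulr1n => ->.
rewrite (sum_fnat (fun j => fnat j *: u j) pc) summxE.
by apply: eq_bigr => i _; rewrite mxE fnatE mulrC.
Qed.

Lemma fnat_regular : regular_upto fnat c.
Proof.
move=> p s pc; rewrite scale_scalar_mx => H; apply/span_in_ideal; first exact: ltnW.
apply: (@ci_fseq_regular _ _ _ _ X (Ordinal pc)); apply/span_in_ideal; first exact: ltnW.
by rewrite -(fnatE (Ordinal pc)).
Qed.

End Setting.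

Section HMFInduction.
Variables (S : comUnitRingType) (k : fieldType) (R : comNzRingType) (c : nat).
Variables (X : ci_setting S k R c) (H : hmf X).
Hypothesis Hmin : hmf_minimal H.

Notation f := (fnat X).
Notation d := (hmf_d H).
Notation A0 := (@hmf_A0 _ _ _ _ _ H).
Notation A1 := (@hmf_A1 _ _ _ _ _ H).
Local Notation "A ~[ p ] B" := (eqmodI f p A B) (at level 70, no associativity).
Local Notation "A ^r" := (map_mx (res X) A) (at level 2, format "A ^r").

Lemma filtration_basis n (A : nat -> 'rV[S]_n -> Prop) p :
  hmf_filtration c A -> (p <= c)%N -> exists r (b : 'M[S]_(r, n)), is_basis (A p) b.
Proof.
move=> [_ Ac _ Afree]; rewrite leq_eqVlt => /predU1P[->|/Afree[[r [b bP]] _]].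
  exists n, 1%:M; split=> [x|a a']; last by rewrite !mulmx1.
  by split=> // _; exists x; rewrite mulmx1.
by exists r, b.
Qed.

(** Descending induction from A(c), the whole free module. The right inverse reads off coordinates
    by a matrix; it splits the inclusion of one stage into the next and carries minimality over to
    matrices in the chosen bases. *)
Lemma filtration_right_inverse n (A : nat -> 'rV[S]_n -> Prop) p r (b : 'M[S]_(r, n)) :
    hmf_filtration c A -> (p <= c)%N -> is_basis (A p) b ->
  exists q, b *m q = 1%:M.
Proof.
move=> FA; have [m] := ubnP (c - p); elim: m p r b => // m IHm p r b cpm.
rewrite leq_eqVlt => /predU1P[pc|pc] bP.
  have [|W WE] := @basis_coords _ _ _ _ _ _ (1%:M : 'M_n) bP.
    by move=> i; rewrite pc; case: FA.
  by exists W; apply: (basis_inj bP); rewrite mul1mx -mulmxA -WE mulmx1.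
have [r' [b' bP']] := filtration_basis FA pc.
have cpm' : (c - p.+1 < m)%N by apply: leq_trans (ltn_sub2l pc (ltnSn p)) cpm.
have [q' bq'] := IHm p.+1 r' b' cpm' pc bP'.
have [_ _ _ /(_ p pc)[_ dA]] := FA.
apply: summand_right_inverse bP bP' dA bq'.
Qed.

Lemma span_mul_basis p n (U : 'rV[S]_n -> Prop) r (b : 'M_(r, n)) m (Y : 'M_(m, n)) :
    (p <= c)%N -> is_basis U b -> (forall i, span_mul (fseq X) p U (row i Y)) ->
  exists W : 'M_(m, r), W ~[p] 0 /\ Y = W *m b.
Proof.
move=> pc bU YU.
have /fin_all_exists[u uP] i : exists u : 'I_c -> 'rV[S]_n,
    (forall j, U (u j)) /\ row i Y = \sum_(j < c | (j < p)%N) fseq X j *: u j.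
  exact: YU.
have /fin_all_exists[w wP] (j : 'I_c) : exists W : 'M_(m, r), \matrix_i u i j = W *m b.
  by apply: basis_coords bU _ => i; rewrite rowK; have [] := uP i.
exists (\sum_(j < p) f j *: onat 0 w j); split.
  by apply/eqmodI0; exact: (in_ideal_sum f p (onat 0 w)).
rewrite (sum_fnat (fun j => f j *: onat 0 w j) pc) mulmx_suml.
apply/row_matrixP => i; have [_ ->] := uP i; rewrite linear_sum.
apply: eq_bigr => j _; rewrite onatE fnatE -scalemxAl -wP; apply/rowP => l.
by rewrite !mxE.
Qed.

Lemma retract_refl p m n (E : 'M[S]_(m, n)) : retract f p E E.
Proof.
exists 1%:M, 1%:M, 1%:M, 1%:M, 0.
by rewrite !mulmx1 !mul1mx mul0mx addr0; split; reflexivity.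
Qed.

Definition zero_lcplx : lcplx S := LCplx (lrk := fun=> 0%N) (fun=> 0) (fun _ _ => 0).

Lemma zero_resolves : resolves f 0 zero_lcplx.
Proof.
split=> [i|i m x _]; first by rewrite big_ord0 mulmx0.
by exists 0; rewrite [x]thinmx0 [X in eqmodI _ _ _ X]thinmx0; reflexivity.
Qed.

(** The claim ranges over all bases and all resolutions at stage p, because the resolution it is
    used for is constructed inside the induction step, independently of the given [C]. *)
Lemma hmf_steps p : (p <= c)%N ->
  forall r0 (b0 : 'M_(r0, _)) r1 (b1 : 'M_(r1, _)) (E : 'M_(r1, r0)),
    is_basis (A0 p) b0 -> is_basis (A1 p) b1 -> E *m b0 = b1 *m d ->
  forall C, resolves f p C -> retract f p (ld C 0) E ->
  gen_step (res X) p C /\ rel_step (res X) p C.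
Proof.
have f_res := fnat_res X; have f_reg := @fnat_regular _ _ _ _ X.
have [F0 F1] := (hmf_filt0 H, hmf_filt1 H).
elim: p => [_|p IHp pc] r0 b0 r1 b1 E bP0 bP1 bE C rC CE.
  (* Stage 0 is the zero module, so its resolutions are retracts of the zero complex. *)
  have CZ : retract f 0 (ld C 0) (ld zero_lcplx 0).
    have [a0 [e0 [a1 [e1 [s0 [_ _ ae]]]]]] := CE.
    exists 0, 0, 0, 0, s0; rewrite !mulmx0 !mul0mx; split; try by reflexivity.
    rewrite -ae [a0](_ : _ = 0) ?mul0mx; first by reflexivity.
    apply: (basis_inj bP0); rewrite mul0mx; apply/row_matrixP => i.
    by rewrite row_mul row0; case: F0 => A00 _ _ _; apply/A00; apply: basis_mem bP0.
  split; last by move=> n q z; rewrite ltn0.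
  apply: (gen_step_retract f_res f_reg _ rC zero_resolves CZ) => // n z _.
  exists (fun=> 0), 0; split=> [j|]; first by rewrite /cocycle mulmx0.
  by rewrite flatmx0 [RHS]flatmx0.
have [r0' [b0' bP0']] := filtration_basis F0 (ltnW pc).
have [r1' [b1' bP1']] := filtration_basis F1 (ltnW pc).
have [q0 bq0] := filtration_right_inverse F0 pc bP0.
have [q1 bq1] := filtration_right_inverse F1 pc bP1.
have [q0' bq0'] := filtration_right_inverse F0 (ltnW pc) bP0'.
have [q1' bq1'] := filtration_right_inverse F1 (ltnW pc) bP1'.
have le_filt n (A : nat -> 'rV[S]_n -> Prop) x : hmf_filtration c A -> A p x -> A p.+1 x.
  case=> _ _ Asub /(_ p pc)[_ [Q [Qsub AE _]]] Ax; apply/AE; exists x, 0.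
  by rewrite addr0; split=> //; case: Qsub.
have [J0 JE0] : exists J, b0' = J *m b0.
  by apply: basis_coords bP0 _ => i; apply: (le_filt _ _ _ F0); apply: basis_row bP0'.
have [J1 JE1] : exists J, b1' = J *m b1.
  by apply: basis_coords bP1 _ => i; apply: (le_filt _ _ _ F1); apply: basis_row bP1'.
have [E' bE'] : exists E', b1' *m d = E' *m b0'.
  apply: basis_coords bP0' _ => i; rewrite row_mul.
  by apply: hmf_d_filt; [apply: ltnW | apply: basis_row bP1'].
pose P := Ordinal pc.
have [h hE] : exists h, b0 *m hmf_h H P = h *m b1.
  apply: basis_coords bP1 _ => i; rewrite row_mul.
  by apply: hmf_h_filt => //; apply: basis_row bP0.
have Emin : E^r = 0.
  have -> : E = b1 *m d *m q0 by rewrite -bE -mulmxA bq0 mulmx1.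
  suff d0 : (b1 *m d)^r = 0 by rewrite map_mxM d0 mul0mx.
  apply/row_matrixP => i; rewrite -map_row row_mul Hmin.1 row0 //.
have hmin : h^r = 0.
  have -> : h = b0 *m hmf_h H P *m q1 by rewrite hE -mulmxA bq1 mulmx1.
  suff h0 : (b0 *m hmf_h H P)^r = 0 by rewrite map_mxM h0 mul0mx.
  apply/row_matrixP => i; rewrite -map_row row_mul Hmin.2 ?row0 //.
  exact: basis_row bP0.
have hEp : h *m E ~[p] (f p)%:M.
  have [|W [W0 WE]] :=
      span_mul_basis (Y := b0 *m hmf_h H P *m d - fseq X P *: b0) (ltnW pc) bP0.
    move=> i; have := @hmf_dh _ _ _ _ _ H P _ (basis_row i bP0).
    by rewrite row_subZ !row_mul.
  apply/eqmodI_sub0; rewrite -W0; suff -> : h *m E - (f p)%:M = W by reflexivity.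
  apply: (basis_inj bP0); rewrite -WE mulmxBl mul_scalar_mx.
  rewrite -[h *m E *m b0]mulmxA bE mulmxA -hE.
  by rewrite (fnatE X P).
(* Condition (b) holds in the quotient by A_1(p), in the usual indexing A_1(p-1); the element of
   that submodule left undetermined becomes U J1. *)
have Ehp : exists U, E *m h ~[p] (f p)%:M + U *m J1.
  have /fin_all_exists[yz yzP] i : exists yz : 'rV[S]_(hmf_n1 H) * 'rV[S]_(hmf_n1 H),
      [/\ A1 p yz.1, span_mul (fseq X) p (A1 p.+1) yz.2 &
          row i (b1 *m d *m hmf_h H P - fseq X P *: b1) = yz.1 + yz.2].
    have [y [z [Ay Az yzE]]] := @hmf_hd _ _ _ _ _ H P _ (basis_row i bP1).
    by exists (y, z); split=> //; rewrite -yzE row_subZ !row_mul.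
  have [|U UE] := @basis_coords _ _ _ _ _ _ (\matrix_i (yz i).1) bP1'.
    by move=> i; rewrite rowK; have [] := yzP i.
  have [|W [W0 WE]] := span_mul_basis (Y := \matrix_i (yz i).2) (ltnW pc) bP1.
    by move=> i; rewrite rowK; have [] := yzP i.
  exists U; apply/eqmodI_sub0; rewrite -W0.
  suff -> : E *m h - ((f p)%:M + U *m J1) = W by reflexivity.
  apply: (basis_inj bP1); rewrite -WE mulmxBl mulmxDl mul_scalar_mx -!mulmxA -hE -JE1 -UE.
  rewrite [E *m _]mulmxA bE opprD addrA (fnatE X P); apply/eqP; rewrite subr_eq; apply/eqP.
  by apply/row_matrixP => i; have [_ _ ->] := yzP i; apply/rowP => j; rewrite !mxE addrC.
have JE : J1 *m E = E' *m J0.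
  by apply: (basis_inj bP0); rewrite -!mulmxA bE -JE0 -bE' mulmxA JE1.
have JK0 : J0 *m (b0 *m q0') = 1%:M by rewrite mulmxA -JE0 bq0'.
have JK1 : J1 *m (b1 *m q1') = 1%:M by rewrite mulmxA -JE1 bq1'.
have S_noeth : noetherian S by case: (ci_regular_local X).
have [r [D [t [DE]]]] := resolution_ex S_noeth f p E'.
set C' := LCplx D t => rC'.
have C'E : ld C' 0 = E' by [].
have CE' : retract f p (ld C' 0) E' by rewrite C'E; apply: retract_refl.
have [genC' relC'] := IHp (ltnW pc) r0' b0' r1' b1' E' bP0' bP1' (esym bE') C' rC' CE'.
rewrite -C'E in JE.
(* [B] climbs from stage p and the cone of [C] descends from p+1 relations; both resolve the module
   of stage p+1 over the first p relations. The properties pass from [B] to the cone and from the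
   cone to [C]. *)
pose B := @box S C' r0 r1 E J0 J1.
have rB : resolves f p B := box_resolves f_reg pc rC' JK0 JK1 JE Ehp.
have genB : gen_step (res X) p B.
  exact: (@box_gen_step _ _ _ p C' _ _ E J0 J1 _ _ JK0 JK1 Emin genC').
have relB : rel_step (res X) p B.
  exact: (@box_rel_step _ _ _ p C' _ _ E J0 J1 _ _ JK0 JK1 Emin relC').
have rK := cone_resolves f_reg pc rC.
have KB : retract f p (ld (cone f_reg pc rC) 0) (ld B 0) :=
  cone_retract f_reg pc rC hEp CE.
have genK := gen_step_retract f_res f_reg (ltnW pc) rK rB KB genB.
have relK := rel_step_retract f_res f_reg (ltnW pc) rK rB KB relB.
have chi0 := chi_inj_retract f_res f_reg pc rC CE hEp hmin.
split; first exact: cone_gen_step genK chi0.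
exact: cone_rel_step genK chi0 relK.
Qed.

End HMFInduction.

(** * Linear presentations of graded modules *)

Section Tensor.
Variables (k : fieldType) (c : nat) (V : vectType k).
Implicit Types (v : V) (u : tens c V) (p : {mpoly k[c]}).
Local Notation b := (vbasis {:V}).

Lemma pureP a v v' p : pure (a *: v + v') p = a%:MP *: pure v p + pure v' p :> tens c V.
Proof.
by apply/rowP => i; rewrite !mxE linearP scalerDl /= mul_mpolyC scalerA.
Qed.

Lemma pure0 p : pure 0 p = 0 :> tens c V.
Proof. by apply/rowP => i; rewrite !mxE linear0 scale0r. Qed.

Lemma scale_pure v p : p *: pure v 1 = pure v p :> tens c V.
Proof. by apply/rowP => i; rewrite !mxE -scalerAr mulr1. Qed.

Lemma tens_basis u : u = \sum_i (u : 'rV__) 0 i *: (pure b`_i 1 : tens c V).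
Proof.
apply/rowP => j; rewrite summxE (bigD1 j) //= big1 ?addr0 => [|i ij].
  by rewrite !mxE coord_free ?eqxx ?scale1r ?mulr1 // (basis_free (vbasisP _)).
by rewrite !mxE coord_free ?(basis_free (vbasisP _)) // (negPf ij) scale0r mulr0.
Qed.

Variable P : lmodType {mpoly k[c]}.
Variable g : V -> P.
Hypothesis gP : forall a v v', g (a *: v + v') = a%:MP *: g v + g v'.

(** [P] is a module over the polynomial ring only, so the k-linearity of [g] is expressed with
    constant polynomials. *)
Definition tens_ext u : P := \sum_i (u : 'rV__) 0 i *: g b`_i.

Fact tens_ext_is_linear : linear tens_ext.
Proof.
move=> p u u'; rewrite /tens_ext scaler_sumr -big_split; apply: eq_bigr => i _.
by rewrite !mxE scalerDl scalerA.
Qed.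
HB.instance Definition _ :=
  GRing.isLinear.Build {mpoly k[c]} (tens c V) P *:%R tens_ext tens_ext_is_linear.

Lemma tens_ext_pure v p : tens_ext (pure v p) = p *: g v.
Proof.
have g0 : g 0 = 0.
  have := gP (-1) 0 0.
  by rewrite scaler0 addr0 mpolyCN mpolyC1 scaleN1r addNr.
rewrite [in RHS](coord_vbasis (memvf v)) /tens_ext.
have -> : g (\sum_i coord b i v *: b`_i) = \sum_i (coord b i v)%:MP *: g b`_i.
  elim: (index_enum _) => [|i s IHs]; first by rewrite !big_nil.
  by rewrite !big_cons gP IHs.
rewrite scaler_sumr; apply: eq_bigr => i _.
by rewrite !mxE scalerA [_ * _%:MP]mulrC mul_mpolyC.
Qed.

(* Polynomials of degree less than d with coefficients in V. *)
Fixpoint bounded d u : Prop :=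
  match d with
  | 0 => u = 0
  | d'.+1 => exists v (w : 'I_c -> tens c V),
      (forall i, bounded d' (w i)) /\ u = pure v 1 + \sum_i 'X_i *: w i
  end.

Lemma bounded0 d : bounded d 0.
Proof.
elim: d => //= d IHd; exists 0, (fun=> 0); split=> //.
by rewrite pure0 add0r big1 // => i _; rewrite scaler0.
Qed.

Lemma boundedS d u : bounded d u -> bounded d.+1 u.
Proof.
elim: d u => [|d IHd] u; first by move=> ->; apply: bounded0.
by move=> [v [w [Bw ->]]]; exists v, w; split=> // i; apply/IHd/Bw.
Qed.

Lemma bounded_pure d v : bounded d.+1 (pure v 1).
Proof.
exists v, (fun=> 0); split=> [i|]; first exact: bounded0.
by rewrite big1 ?addr0 // => i _; rewrite scaler0.
Qed.

Lemma boundedP d a u u' : bounded d u -> bounded d u' -> bounded d (a%:MP *: u + u').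
Proof.
elim: d u u' => [|d IHd] u u' /=; first by move=> -> ->; rewrite scaler0 addr0.
move=> [v [w [Bw ->]]] [v' [w' [Bw' ->]]].
exists (a *: v + v'), (fun i => a%:MP *: w i + w' i); split=> [i|]; first exact: IHd.
rewrite pureP scalerDr addrACA; congr (_ + _); rewrite scaler_sumr -big_split.
by apply: eq_bigr => i _; rewrite scalerDr !scalerA mulrC.
Qed.

Lemma boundedZ d a u : bounded d u -> bounded d (a%:MP *: u).
Proof. by move=> Bu; rewrite -[_ *: _]addr0; apply: boundedP => //; apply: bounded0. Qed.

Lemma boundedD d u u' : bounded d u -> bounded d u' -> bounded d (u + u').
Proof. by move=> Bu Bu'; rewrite -[u]scale1r -mpolyC1; apply: boundedP. Qed.

Lemma boundedN d u : bounded d u -> bounded d (- u).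
Proof. by move=> Bu; rewrite -scaleN1r -mpolyC1 -mpolyCN; apply: boundedZ. Qed.

Lemma bounded_sumX d (Q : pred 'I_c) (w : 'I_c -> tens c V) :
  (forall i, Q i -> bounded d (w i)) -> bounded d.+1 (\sum_(i | Q i) 'X_i *: w i).
Proof.
move=> Bw; exists 0, (fun i => if Q i then w i else 0); split=> [i|].
  by case: ifP => [/Bw //|_]; apply: bounded0.
rewrite pure0 add0r big_mkcond; apply: eq_bigr => i _.
by case: ifP => // _; rewrite scaler0.
Qed.

Lemma boundedX d i u : bounded d u -> bounded d.+1 ('X_i *: u).
Proof.
move=> Bu; have -> : 'X_i *: u = \sum_(j | j == i) 'X_j *: u by rewrite big_pred1_eq.
exact: bounded_sumX.
Qed.

Lemma bounded_leq d d' u : (d <= d')%N -> bounded d u -> bounded d' u.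
Proof.
move=> /subnKC <-; elim: (d' - d)%N => [|n IHn] Bu; first by rewrite addn0.
by rewrite addnS; apply/boundedS/IHn.
Qed.

Lemma bounded_ex u : exists d, bounded d u.
Proof.
have exD x y : (exists d, bounded d x) -> (exists d, bounded d y) ->
    exists d, bounded d (x + y).
  move=> [d Bx] [d' By]; exists (maxn d d').
  by apply: boundedD; [apply: bounded_leq Bx | apply: bounded_leq By];
    rewrite ?leq_maxl ?leq_maxr.
have ex0 : exists d, bounded d 0 by exists 0%N.
have exM p x : (exists d, bounded d x) -> exists d, bounded d (p *: x).
  move=> Bx; elim/mpolyind: p => [|a m p _ _ IHp]; first by rewrite scale0r.
  rewrite scalerDl; apply: exD => //; rewrite -mul_mpolyC -scalerA mpolyXE_id.
  suff [d Bd] : exists d, bounded d ((\prod_(i < c) 'X_i ^+ m i : {mpoly k[c]}) *: x).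
    by exists d; apply: boundedZ.
  elim/big_rec: _ => [|i y _ [d Bd]]; first by rewrite scale1r.
  rewrite -scalerA; exists (m i + d)%N; elim: (m i) => [|n IHn]; first by rewrite scale1r.
  by rewrite exprS -scalerA; apply: boundedX.
rewrite [u]tens_basis; elim/big_ind: _ => // i _; apply: exM.
by exists 1%N; apply: bounded_pure.
Qed.

End Tensor.

Section Presentation.
Variables (k : fieldType) (c : nat) (N : grmod k c) (V V' : vectType k).
Variables (e : {linear V -> gr_deg N 0}) (rho : 'I_c -> {linear V' -> V}).
Hypothesis e_inj : forall v, e v = 0 -> v = 0.
Hypothesis e_surj : forall x, exists v, e v = x.
Hypothesis N_gen : forall j (x : gr_deg N j.+1),
  exists w : 'I_c -> gr_deg N j, x = \sum_i gr_chi N i j (w i).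
Hypothesis rho_rel : forall w, \sum_i gr_chi N i 0 (e (rho i w)) = 0.
Hypothesis rel_rho : forall v : 'I_c -> V, \sum_i gr_chi N i 0 (e (v i)) = 0 ->
  exists w, forall i, v i = rho i w.
Hypothesis N_rel : forall j (q : 'I_c) (x : 'I_c -> gr_deg N j.+1),
  \sum_(i < c | (q <= i)%N) gr_chi N i j.+1 (x i) = 0 ->
  exists w : 'I_c -> gr_deg N j, x q = \sum_(i < c | (q < i)%N) gr_chi N i j (w i).

Lemma gr_compD (x y : gr_total N) j : gr_comp (x + y) j = gr_comp x j + gr_comp y j.
Proof. by []. Qed.

Lemma gr_comp_sum (I : Type) (r : seq I) (P : pred I) (x : I -> gr_total N) j :
  gr_comp (\sum_(i <- r | P i) x i) j = \sum_(i <- r | P i) gr_comp (x i) j.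
Proof. by apply: (big_morph (fun x : gr_total N => gr_comp x j)). Qed.

Lemma gr_compX0 i (x : gr_total N) : gr_comp ('X_i *: x) 0 = 0.
Proof. by rewrite /GRing.scale /= /gr_act poly_act_var. Qed.

Fact in0_linear a v v' :
  gr_in0 (e (a *: v + v')) = a%:MP *: gr_in0 (e v) + gr_in0 (e v') :> gr_total N.
Proof.
apply: gr_sumP => j; rewrite gr_compD.
have -> : a%:MP *: gr_in0 (e v) = gr_scale a (gr_in0 (e v)) :> gr_total N.
  rewrite /GRing.scale /= /gr_act -[a%:MP]mulr1 mul_mpolyC poly_actZ poly_act1 //.
case: j => [|j] /=; first by rewrite linearP.
by rewrite scaler0 addr0.
Qed.

Definition eps : {linear tens c V -> gr_total N} :=
  tens_ext (c := c) (fun v => gr_in0 (e v) : gr_total N).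

Lemma eps_pure v : eps (pure v 1) = gr_in0 (e v).
Proof. by rewrite /= tens_ext_pure ?scale1r //; exact: in0_linear. Qed.

Definition tau_gen (w : V') : tens c V := \sum_i pure (rho i w) 'X_i.

Fact tau_gen_linear a w w' : tau_gen (a *: w + w') = a%:MP *: tau_gen w + tau_gen w'.
Proof.
rewrite /tau_gen scaler_sumr -big_split; apply: eq_bigr => i _.
by rewrite linearP pureP.
Qed.

Definition tau : {linear tens c V' -> tens c V} := tens_ext tau_gen.

Lemma tau_pure w : tau (pure w 1) = \sum_i pure (rho i w) 'X_i.
Proof. by rewrite /= tens_ext_pure ?scale1r //; exact: tau_gen_linear. Qed.

Lemma eps_sum0 (P : pred 'I_c) (w : 'I_c -> tens c V) :
  gr_comp (eps (\sum_(i | P i) 'X_i *: w i)) 0 = 0.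
Proof.
rewrite linear_sum gr_comp_sum big1 // => i _.
by rewrite linearZ gr_compX0.
Qed.

Lemma eps_sumS (P : pred 'I_c) (w : 'I_c -> tens c V) j :
  gr_comp (eps (\sum_(i | P i) 'X_i *: w i)) j.+1 =
  \sum_(i | P i) gr_chi N i j (gr_comp (eps (w i)) j).
Proof.
rewrite linear_sum gr_comp_sum.
by apply: eq_bigr => i _; rewrite linearZ gr_total_varE.
Qed.

Lemma eps_comp0 v (w : 'I_c -> tens c V) :
  gr_comp (eps (pure v 1 + \sum_i 'X_i *: w i)) 0 = e v.
Proof. by rewrite linearD gr_compD eps_sum0 addr0 eps_pure. Qed.

Lemma eps_compS v (w : 'I_c -> tens c V) j :
  gr_comp (eps (pure v 1 + \sum_i 'X_i *: w i)) j.+1 =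
  \sum_i gr_chi N i j (gr_comp (eps (w i)) j).
Proof. by rewrite linearD gr_compD eps_sumS eps_pure add0r. Qed.

Lemma eps_tau w : eps (tau w) = 0.
Proof.
rewrite [w]tens_basis (linear_sum tau) (linear_sum eps) big1 // => i _.
rewrite (linearZ_LR tau) (linearZ_LR eps) tau_pure (linear_sum eps).
suff -> : \sum_i0 eps (pure (rho i0 (vbasis {:V'})`_i) 'X_i0) = 0 by rewrite scaler0.
apply: gr_sumP => -[|j]; rewrite gr_comp_sum.
  by rewrite big1 // => l _; rewrite -scale_pure linearZ gr_compX0.
under eq_bigr do rewrite -scale_pure linearZ gr_total_varE eps_pure.
by case: j => [|j]; [exact: rho_rel | rewrite big1 // => l _; exact: linear0].
Qed.

Lemma eps_bounded d u : bounded d u -> forall j, (d <= j)%N -> gr_comp (eps u) j = 0.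
Proof.
elim: d u => [|d IHd] u; first by move=> -> j _; rewrite linear0.
move=> [v [w [Bw ->]]] [//|j] dj; rewrite eps_compS big1 // => i _.
by rewrite (IHd _ (Bw i)) ?linear0.
Qed.

(** Coefficients chosen in every degree form an element of the direct sum only after being cut off
    at a degree bound. *)
Lemma truncations d (w : forall j, 'I_c -> gr_deg N j) :
  exists x : 'I_c -> gr_total N,
    forall i j, gr_comp (x i) j = if (j < d)%N then w j i else 0.
Proof.
have fin i : exists n, forall j, (n <= j)%N -> (if (j < d)%N then w j i else 0) = 0.
  by exists d => j; rewrite ltnNge => ->.
by exists (fun i => GrSum (fin i)).
Qed.

(** Keeping the degree bound of [z] for its preimage is what lets the corrections in [ker_eps_step]
    fall under the induction on degree. *)
Lemma eps_surj_bounded d (z : gr_total N) :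
  (forall j, (d <= j)%N -> gr_comp z j = 0) -> exists u, bounded d u /\ eps u = z.
Proof.
elim: d z => [|d IHd] z z0.
  by exists 0; split=> //; rewrite linear0; apply: gr_sumP => j; rewrite z0.
have [v ev] := e_surj (gr_comp z 0).
pose w j := sval (cid (N_gen (gr_comp z j.+1))).
have wE j : gr_comp z j.+1 = \sum_i gr_chi N i j (w j i).
  exact: (svalP (cid (N_gen (gr_comp z j.+1)))).
have [x xP] := truncations d w.
have /fin_all_exists[u uP] i : exists u, bounded d u /\ eps u = x i.
  by apply: IHd => j dj; rewrite xP ltnNge dj.
exists (pure v 1 + \sum_i 'X_i *: u i); split.
  by exists v, u; split=> // i; have [] := uP i.
apply: gr_sumP => -[|j]; first by rewrite eps_comp0.
rewrite eps_compS; have [jd|dj] := ltnP j d.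
  by rewrite wE; apply: eq_bigr => i _; have [_ ->] := uP i; rewrite xP jd.
rewrite z0 // big1 // => i _; have [_ ->] := uP i.
by rewrite xP ltnNge dj linear0.
Qed.

(** Elimination of X_q. By [N_rel] the image of y_q is a combination of the chi_i with i > q.
    Lifting its coefficients to u_i, the difference of y_q and sum X_i u_i is a relation covered by
    the induction on degree, and each X_q X_i u_i moves into the coefficient of X_i. *)
Lemma ker_eps_step d q (y : 'I_c -> tens c V) :
    (forall u, bounded d.+1 u -> eps u = 0 -> exists w, u = tau w) ->
    (q <= c)%N -> (forall i, bounded d.+1 (y i)) ->
    (forall i, gr_comp (eps (y i)) 0 = 0) ->
    eps (\sum_(i < c | (q <= i)%N) 'X_i *: y i) = 0 ->
  exists w, \sum_(i < c | (q <= i)%N) 'X_i *: y i = tau w.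
Proof.
move=> IHd; have [m] := ubnP (c - q); elim: m => // m IHm in q y * => cqm.
rewrite leq_eqVlt => /predU1P[->|qc] By y0 ey0.
  by exists 0; rewrite linear0 big_pred0 // => i; rewrite leqNgt ltn_ord.
pose Q := Ordinal qc.
have splitQ (W : nmodType) (F : 'I_c -> W) : \sum_(i < c | (q <= i)%N) F i =
    F Q + \sum_(i < c | (q < i)%N) F i.
  rewrite (bigD1 Q) //=; congr (_ + _); apply: eq_bigl => i.
  by rewrite [RHS]ltn_neqAle andbC eq_sym -val_eqE.
have rel j : exists w : 'I_c -> gr_deg N j, gr_comp (eps (y Q)) j.+1 =
    \sum_(i < c | (Q < i)%N) gr_chi N i j (w i).
  apply: (N_rel (x := fun i => gr_comp (eps (y i)) j.+1)).
  by rewrite -(eps_sumS (fun i => Q <= i)%N) ey0.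
pose w j := sval (cid (rel j)).
have wE j : gr_comp (eps (y Q)) j.+1 = \sum_(i < c | (Q < i)%N) gr_chi N i j (w j i).
  exact: (svalP (cid (rel j))).
have [x xP] := truncations d w.
have /fin_all_exists[u uP] i : exists u, bounded d u /\ eps u = x i.
  by apply: eps_surj_bounded => j dj; rewrite xP ltnNge dj.
have [Bu eu] : (forall i, bounded d (u i)) /\ forall i, eps (u i) = x i.
  by split=> i; have [] := uP i.
have [w1 w1E] : exists w, y Q - \sum_(i < c | (q < i)%N) 'X_i *: u i = tau w.
  apply: IHd.
    by apply: boundedD => //; apply/boundedN/bounded_sumX.
  rewrite (linearB eps); apply/eqP; rewrite subr_eq0; apply/eqP.
  apply: gr_sumP => -[|j]; first by rewrite y0 eps_sum0.
  rewrite eps_sumS; have [jd|dj] := ltnP j d.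
    by rewrite wE; apply: eq_bigr => i _; rewrite eu xP jd.
  rewrite (eps_bounded (By Q)) // big1 // => i _.
  by rewrite eu xP ltnNge dj linear0.
pose y' i := y i + 'X_Q *: u i.
have sumE : \sum_(i < c | (q <= i)%N) 'X_i *: y i =
    'X_Q *: tau w1 + \sum_(i < c | (q < i)%N) 'X_i *: y' i.
  rewrite splitQ -w1E scalerBr scaler_sumr -addrA; congr (_ + _).
  rewrite addrC -sumrB; apply: eq_bigr => i _.
  by rewrite /y' scalerDr !scalerA ['X_i * 'X_Q]mulrC addrK.
have [|||||w2 w2E] := IHm q.+1 y'.
- by apply: leq_trans (ltn_sub2l qc (ltnSn q)) cqm.
- exact: qc.
- by move=> i; apply: boundedD => //; apply: boundedX.
- by move=> i; rewrite linearD gr_compD y0 add0r linearZ gr_compX0.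
- by move: ey0; rewrite sumE linearD linearZ /= eps_tau scaler0 add0r.
by exists ('X_Q *: w1 + w2); rewrite sumE w2E linearP.
Qed.

Lemma ker_eps d u : bounded d u -> eps u = 0 -> exists w, u = tau w.
Proof.
elim: d u => [|d IHd] u; first by move=> -> _; exists 0; rewrite linear0.
move=> [v [w [Bw ->]]] e0.
(* Degree 0 kills the constant term, degree 1 is matched by [rel_rho], and what remains has
   coefficients without constant term. *)
have v0 : v = 0 by apply: e_inj; rewrite -(eps_comp0 v w) e0.
rewrite {}v0 pure0 add0r in e0 *; move=> {v}.
case: d => [|d] in IHd Bw *.
  by exists 0; rewrite linear0 big1 // => i _; rewrite Bw scaler0.
have /fin_all_exists[v vP] i : exists v, exists x : 'I_c -> tens c V,
  (forall l, bounded d (x l)) /\ w i = pure v 1 + \sum_l 'X_l *: x l by apply: Bw.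
have {vP}/fin_all_exists[x xP] := vP.
have [|w0 w0E] := rel_rho (v := v).
  have := congr1 (fun z => gr_comp z 1) e0; rewrite /= eps_sumS.
  by apply: etrans; apply: eq_bigr => i _; have [_ ->] := xP i; rewrite eps_comp0.
pose y i := \sum_l 'X_l *: x i l.
have sumE : \sum_i 'X_i *: w i = tau (pure w0 1) + \sum_i 'X_i *: y i.
  rewrite tau_pure -big_split; apply: eq_bigr => i _.
  by have [_ ->] := xP i; rewrite scalerDr scale_pure w0E.
have [|||w1 w1E] := @ker_eps_step d 0 y IHd (leq0n c).
- by move=> i; apply: bounded_sumX => l _; have [] := xP i.
- by move=> i; rewrite eps_sum0.
- by move: e0; rewrite sumE linearD /= eps_tau add0r.
by exists (pure w0 1 + w1); rewrite sumE linearD /= -w1E.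
Qed.

Theorem linear_presentation :
  [/\ forall w, tau (pure w 1) = \sum_i pure (rho i w) 'X_i,
      forall v, eps (pure v 1) = gr_in0 (e v),
      forall z, exists u, eps u = z &
      forall u, eps u = 0 <-> exists w, u = tau w].
Proof.
split=> [w|v|z|u]; [exact: tau_pure | exact: eps_pure | | ].
  by have [n zn] := gr_fin z; have [u [_ <-]] := eps_surj_bounded zn; exists u.
split=> [|[w ->]]; last exact: eps_tau.
by have [d Bu] := bounded_ex u; apply: ker_eps Bu.
Qed.

End Presentation.

(** * Presentations over S *)

Section Semilinear.
Variables (S : comUnitRingType) (k : fieldType) (R : comNzRingType) (c : nat).
Variables (X : ci_setting S k R c) (M : lmodType R).
Notation f := (fnat X).
Local Notation "A ~[ p ] B" := (eqmodI f p A B) (at level 70, no associativity).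
Local Notation "A ^q" := (map_mx (quo X) A) (at level 2, format "A ^q").

Lemma quo_lift m n (Y : 'M[R]_(m, n)) : exists Y', Y'^q = Y.
Proof.
pose g r := sval (cid (ci_quo_surj X r)).
exists (map_mx g Y); apply/matrixP => i j; rewrite !mxE.
exact: (svalP (cid (ci_quo_surj X (Y i j)))).
Qed.

Lemma quo_eqmodI m n (A B : 'M[S]_(m, n)) : A^q = B^q <-> A ~[c] B.
Proof.
split=> [AB|[u uE]].
  have [u uE] : exists u : 'I_c -> 'M[S]_(m, n), A - B = \sum_i fseq X i *: u i.
    by apply: mx_span; rewrite map_mxB AB subrr.
  exists (onat 0 u); rewrite uE; apply: eq_bigr => i _.
  by rewrite onatE fnatE.
apply/eqP; rewrite -subr_eq0 -map_mxB uE map_mx_sum big1 // => i _.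
rewrite map_mxZ fnatE (_ : quo X (fseq X i) = 0) ?scale0r //.
apply/ci_quo_ker; exists (fun j => (j == i)%:R).
rewrite (bigD1 i) ?ltn_ord //= eqxx mul1r big1 ?addr0 // => j /andP[_ /negPf->].
by rewrite mul0r.
Qed.

(** Covers both the augmentation of an S-resolution and that of an R-resolution pulled back to S. *)
Definition quo_linear n (g : 'rV[S]_n -> M) : Prop :=
  forall a x y, g (a *: x + y) = quo X a *: g x + g y.

Lemma quo_linear_comb m n (g : 'rV[S]_n -> M) (x : 'rV[S]_m) (A : 'M_(m, n)) :
  quo_linear g -> g (x *m A) = \sum_i quo X (x 0 i) *: g (row i A).
Proof.
move=> gP; have g0 : g 0 = 0.
  by have := gP (-1) 0 0; rewrite scaler0 addr0 rmorphN1 scaleN1r addNr.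
rewrite mulmx_sum_row; elim: (index_enum _) => [|i s IHs]; first by rewrite !big_nil.
by rewrite !big_cons gP IHs.
Qed.

Lemma quo_linearB n (g : 'rV[S]_n -> M) x y : quo_linear g -> g (x - y) = g x - g y.
Proof. by move=> gP; rewrite [x - y]addrC -[- y]scaleN1r gP rmorphN1 scaleN1r addrC. Qed.

Lemma quo_linear_lift n n' (g : 'rV[S]_n -> M) (g' : 'rV[S]_n' -> M) :
    quo_linear g -> quo_linear g' -> (forall z, exists x, g' x = z) ->
  exists A : 'M[S]_(n, n'), forall x, g x = g' (x *m A).
Proof.
move=> gP g'P g'surj.
have /fin_all_exists[a aE] i : exists x, g' x = g (delta_mx 0 i).
  exact: g'surj.
exists (\matrix_i a i) => x; rewrite -[x in LHS]mulmx1 !quo_linear_comb //.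
by apply: eq_bigr => i _; rewrite rowK aE row1.
Qed.

Definition kernel_mod n m (g : 'rV[S]_n -> M) (D : 'M[S]_(m, n)) : Prop :=
  forall x, g x = 0 <-> exists y : 'rV_m, x ~[c] y *m D.

Lemma kernel_mod_lift n m l (g : 'rV[S]_n -> M) (D : 'M[S]_(m, n)) (Y : 'M_(l, n)) :
  kernel_mod g D -> (forall i, g (row i Y) = 0) -> exists W, Y ~[c] W *m D.
Proof.
move=> gD gY; have /fin_all_exists[w wE] i : exists y : 'rV_m, row i Y ~[c] y *m D.
  by apply/gD.
exists (\matrix_i w i); apply/quo_eqmodI/row_matrixP => i.
by rewrite -!map_row row_mul rowK; apply/quo_eqmodI.
Qed.

(** The identity of [M] lifts in both directions; the composite differs from 1 by rows in the kernel
    of [g], hence by a multiple of [D]. *)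
Lemma presentation_retract n m n' m' (g : 'rV[S]_n -> M) (g' : 'rV[S]_n' -> M)
    (D : 'M[S]_(m, n)) (D' : 'M[S]_(m', n')) :
    quo_linear g -> quo_linear g' ->
    (forall z, exists x, g x = z) -> (forall z, exists x, g' x = z) ->
    kernel_mod g D -> kernel_mod g' D' -> retract f c D D'.
Proof.
move=> gP g'P gs g's gD g'D.
have [A AE] := quo_linear_lift gP g'P g's; have [B BE] := quo_linear_lift g'P gP gs.
have kerD i : g (row i D) = 0.
  by apply/gD; exists (delta_mx 0 i); rewrite rowE; reflexivity.
have kerD' i : g' (row i D') = 0.
  by apply/g'D; exists (delta_mx 0 i); rewrite rowE; reflexivity.
have [a1 a1E] : exists W, D *m A ~[c] W *m D'.
  by apply: (kernel_mod_lift g'D) => i; rewrite row_mul -AE.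
have [b1 b1E] : exists W, D' *m B ~[c] W *m D.
  by apply: (kernel_mod_lift gD) => i; rewrite row_mul -BE.
have [s0 s0E] : exists W, A *m B - 1%:M ~[c] W *m D.
  apply: (kernel_mod_lift gD) => i; rewrite rowE mulmxBr quo_linearB //.
  by rewrite mulmxA -BE -AE mulmx1 subrr.
exists A, B, a1, b1, s0; split=> //.
by rewrite -s0E addrC subrK; reflexivity.
Qed.

End Semilinear.

Section Resolution.
Variables (S : comUnitRingType) (k : fieldType) (R : comNzRingType) (c : nat).
Variables (X : ci_setting S k R c) (M : lmodType R).
Variables (F : free_resolution (idfun : {rmorphism R -> R}) M) (L : ci_lift X F).
Notation f := (fnat X).
Local Notation "A ~[ p ] B" := (eqmodI f p A B) (at level 70, no associativity).
Local Notation "A ^q" := (map_mx (quo X) A) (at level 2, format "A ^q").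

Definition lift_lcplx : lcplx S :=
  LCplx (lift_dif L) (fun j i => onat 0 (fun l => lift_t L l i) j).

Lemma lift_resolves : resolves f c lift_lcplx.
Proof.
split=> [i|i m x /=].
  by rewrite /= lift_tP; apply: eq_bigr => j _; rewrite onatE fnatE.
move=> /quo_eqmodI; rewrite map_mxM lift_difP map_mx0 => x0.
have /fin_all_exists[y yE] l : exists y : 'rV_(rk F i.+2), row l x^q = y *m dif F i.+1.
  by apply/dif_exact; rewrite -row_mul x0 row0.
have [Y YE] := quo_lift X (\matrix_l y l).
exists Y; apply/quo_eqmodI; rewrite map_mxM lift_difP YE.
by apply/row_matrixP => l; rewrite row_mul rowK -yE.
Qed.

Definition aug_lift (x : 'rV[S]_(rk F 0)) : M := aug F x^q.

Lemma aug_lift_quo_linear : quo_linear X aug_lift.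
Proof. by move=> a x y; rewrite /aug_lift map_mxD map_mxZ linearP. Qed.

Lemma aug_lift_surj z : exists x, aug_lift x = z.
Proof.
have [x xz] := aug_surj F z; have [y yx] := quo_lift X x.
by exists y; rewrite /aug_lift yx.
Qed.

Lemma aug_lift_kernel : kernel_mod X aug_lift (lift_dif L 0).
Proof.
move=> x; rewrite /aug_lift aug_exact; split=> -[y xE].
  have [y' y'E] := quo_lift X y; exists y'; apply/quo_eqmodI.
  by rewrite map_mxM lift_difP y'E.
by exists y^q; rewrite -(lift_difP L) -map_mxM; apply/quo_eqmodI.
Qed.

Lemma coker_quo_linear n (q : {linear 'rV[R]_n -> M}) :
  quo_linear X (fun x : 'rV[S]_n => q x^q).
Proof. by move=> a x y; rewrite map_mxD map_mxZ linearP. Qed.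

Lemma coker_surj n m (D : 'M[S]_(m, n)) (q : {linear 'rV[R]_n -> M}) z :
  is_coker D^q q -> exists x : 'rV[S]_n, q x^q = z.
Proof.
by move=> [qs _]; have [x <-] := qs z; have [y <-] := quo_lift X x; exists y.
Qed.

Lemma coker_kernel n m (D : 'M[S]_(m, n)) (q : {linear 'rV[R]_n -> M}) :
  is_coker D^q q -> kernel_mod X (fun x : 'rV[S]_n => q x^q) D.
Proof.
move=> [_ qk] x; rewrite qk; split=> -[y xE].
  have [y' y'E] := quo_lift X y; exists y'; apply/quo_eqmodI.
  by rewrite map_mxM y'E.
by exists y^q; rewrite -map_mxM; apply/quo_eqmodI.
Qed.

End Resolution.

(** * The relations in degree one *)

Section LowDegree.
Variables (S : comUnitRingType) (k : fieldType) (R : comNzRingType) (c : nat).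
Variables (X : ci_setting S k R c) (M : lmodType R).
Variables (F : free_resolution (idfun : {rmorphism R -> R}) M) (L : ci_lift X F).
Variables (G : free_resolution (quo X) M) (sg : homotopies G).
Notation f := (fnat X).
Local Notation "A ~[ p ] B" := (eqmodI f p A B) (at level 70, no associativity).
Local Notation "A ^r" := (map_mx (res X) A) (at level 2, format "A ^r").
Notation C := (lift_lcplx L).

Lemma aug_quo_linear : quo_linear X (aug G).
Proof. by move=> a x y; rewrite linearP. Qed.

Lemma aug_lift0 l (Y : 'M_(l, rk G 0)) :
  (forall i, aug G (row i Y) = 0) -> exists W, Y = W *m dif G 0.
Proof.
move=> Y0; have /fin_all_exists[w wE] i : exists y : 'rV_(rk G 1), row i Y = y *m dif G 0.
  by apply/aug_exact.
by exists (\matrix_i w i); apply/row_matrixP => i; rewrite row_mul rowK.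
Qed.

Lemma dif_lift i l (Y : 'M_(l, rk G i.+1)) :
  Y *m dif G i = 0 -> exists W, Y = W *m dif G i.+1.
Proof.
move=> Y0; have /fin_all_exists[w wE] j : exists y : 'rV_(rk G i.+2), row j Y = y *m dif G i.+1.
  by apply/dif_exact; rewrite -row_mul Y0 row0.
by exists (\matrix_i w i); apply/row_matrixP => j; rewrite row_mul rowK.
Qed.

Lemma dif_dif i : dif G i.+1 *m dif G i = 0.
Proof.
apply/row_matrixP => j; rewrite row0 row_mul; apply/dif_exact.
by exists (delta_mx 0 j); rewrite rowE.
Qed.

Lemma aug_dif l (Y : 'M_(l, rk G 1)) i : aug G (row i (Y *m dif G 0)) = 0.
Proof. by rewrite row_mul; apply/aug_exact; exists (row i Y). Qed.

Lemma tor_bounds_cycles i y : y \in tor_bounds G i -> y \in tor_cycles G i.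
Proof.
case: i y => [|i] y; first by rewrite memvf.
case/memv_imgP => x _ ->; rewrite memv_ker !lfunE /= -mulmxA -map_mxM dif_dif.
by rewrite map_mx0 mulmx0.
Qed.

Lemma mem_tor_bounds i (y : 'rV_(rk G i.+1)) : y *m (dif G i)^r \in tor_bounds G i.
Proof.
have := memv_img (linfun (mulmxr (tor_dif G i))) (memvf y).
by rewrite lfunE.
Qed.

(* tor_cls is defined on all chains, so a functional on Tor_i pulls back to a
   cocycle. *)
Definition ext_vec i (w : extS G i) : 'cV[k]_(rk G i) :=
  \col_l w (tor_cls G i (delta_mx 0 l)).

Lemma ext_vecE i (w : extS G i) y : w (tor_cls G i y) = (y *m ext_vec w) 0 0.
Proof.
rewrite [y in LHS]row_sum_delta /tor_cls !linear_sum mxE; apply: eq_bigr => l _.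
by rewrite !linearZ /= mxE.
Qed.

Lemma ext_vec_cocycle i (w : extS G i) : (dif G i)^r *m ext_vec w = 0.
Proof.
apply/row_matrixP => l; rewrite row_mul row0; apply/rowP => j; rewrite ord1 -ext_vecE.
rewrite rowE; have B := mem_tor_bounds (delta_mx 0 l : 'rV_(rk G i.+1)).
have e0 : tor_cls G i (delta_mx 0 l *m (dif G i)^r) = 0.
  by apply/cls_eq0 => //; apply: tor_bounds_cycles.
by rewrite e0 linear0 mxE.
Qed.

Lemma ext_vec_inj i (w w' : extS G i) : ext_vec w = ext_vec w' -> w = w'.
Proof.
move=> ww; apply/lfunP => x; rewrite -[x]repK.
by have := ext_vecE w (rep x); rewrite ww -ext_vecE.
Qed.

Lemma ext_vecP i a (w w' : extS G i) : ext_vec (a *: w + w') = a *: ext_vec w + ext_vec w'.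
Proof. by apply/colP => l; rewrite !mxE lfunE /= lfunE. Qed.

(** Values are prescribed on cycles, where the class does not depend on the chosen complement. *)
Lemma ext_of_vec i (W : 'cV[k]_(rk G i)) : (dif G i)^r *m W = 0 ->
  exists w : extS G i, forall z, z \in tor_cycles G i -> w (tor_cls G i z) = (z *m W) 0 0.
Proof.
move=> W0; pose g (x : tor G i) : k^o := (rep x *m W) 0 0.
have g_lin : linear g by move=> a x y; rewrite /g linearP mulmxDl -scalemxAl !mxE.
pose gL : {linear tor G i -> k^o} := HB.pack g (GRing.isLinear.Build _ _ _ _ _ g_lin).
exists (linfun gL) => z Zz; rewrite lfunE /= /g.
have := clsP (tor_bounds G i) Zz; case/memv_imgP => y _; rewrite lfunE /= => zE.
rewrite -[z in RHS](subrK (rep (cls (tor_cycles G i) (tor_bounds G i) z))) zE mulmxDl.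
by rewrite -mulmxA W0 mulmx0 add0r.
Qed.

Lemma htp_cycles j z : z *m (htp sg j 0)^r \in tor_cycles G 1.
Proof.
rewrite memv_ker lfunE /= -mulmxA -map_mxM (htpP sg j).1.
by rewrite map_scalar_mx ci_fseq_max mul_mx_scalar scale0r.
Qed.

Lemma mu_cls j (y : 'rV_(rk G 0)) :
  mu sg j (tor_cls G 0 y) = tor_cls G 1 (y *m (htp sg j 0)^r).
Proof.
rewrite lfunE /=; apply: sq_map_cls => [z _|z|]; rewrite ?memvf //; first exact: htp_cycles.
case/memv_imgP => x _ ->; rewrite lfunE /= -mulmxA -map_mxM.
have /esym/eqP := (htpP sg j).2 0%N; rewrite -subr_eq => /eqP <-.
rewrite map_mxB map_scalar_mx ci_fseq_max map_mxM -scalemx1 scale0r sub0r mulmxN.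
by rewrite rpredN mulmxA; apply: mem_tor_bounds.
Qed.

(** It is enough that [W] represents [w] on cycles, since the reduced homotopy sends every 0-chain
    to a cycle. *)
Lemma ext_vec_mu j (w : extS G 1) (W : 'cV_(rk G 1)) :
    (forall z, z \in tor_cycles G 1 -> w (tor_cls G 1 z) = (z *m W) 0 0) ->
  ext_vec (w \o mu sg j)%VF = (htp sg j 0)^r *m W.
Proof.
move=> wW; apply/colP => l; rewrite mxE lfunE /= mu_cls wW ?htp_cycles //.
by rewrite -mulmxA -rowE !mxE.
Qed.


Variables (A : 'M[S]_(rk F 0, rk G 0)) (B : 'M[S]_(rk G 0, rk F 0)).
Hypotheses (AE : forall x, aug_lift X x = aug G (x *m A))
           (BE : forall y, aug G y = aug_lift X (y *m B)).

Notation dt := (lift_dif L).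
Notation t := (lift_t L).

Lemma compAB (z : 'cV_(rk F 0)) : (dt 0)^r *m z = 0 -> A^r *m (B^r *m z) = z.
Proof.
move=> Zz; have [W WE] : exists W, A *m B - 1%:M ~[c] W *m dt 0.
  apply: (kernel_mod_lift (aug_lift_kernel L)) => i.
  rewrite rowE mulmxBr (quo_linearB _ _ (@aug_lift_quo_linear _ _ _ _ X _ F)).
  by rewrite mulmxA -BE -AE mulmx1 subrr.
have /(congr1 (mulmxr z)) := res_eqmodI (fnat_res X) WE.
rewrite /= map_mxB map_mx1 mulmxBl mul1mx !map_mxM -!mulmxA Zz mulmx0.
by move/eqP; rewrite subr_eq0 => /eqP.
Qed.

Lemma compBA (y : 'cV_(rk G 0)) : (dif G 0)^r *m y = 0 -> B^r *m (A^r *m y) = y.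
Proof.
move=> Zy; have [W WE] : exists W, B *m A - 1%:M = W *m dif G 0.
  apply: aug_lift0 => i.
  rewrite rowE mulmxBr (quo_linearB _ _ aug_quo_linear).
  by rewrite mulmxA -AE -BE mulmx1 subrr.
have /(congr1 (mulmxr y)) := congr1 (map_mx (res X)) WE.
rewrite /= map_mxB map_mx1 mulmxBl mul1mx !map_mxM -!mulmxA Zy mulmx0.
by move/eqP; rewrite subr_eq0 => /eqP.
Qed.

Lemma dt_A : exists A1, dt 0 *m A = A1 *m dif G 0.
Proof.
apply: aug_lift0 => i; rewrite row_mul -AE; apply/(aug_lift_kernel L).
by exists (delta_mx 0 i); rewrite rowE; reflexivity.
Qed.

(** The matrices [g] measure how far [B] is from a chain map over S. *)
Lemma dif_B : exists (B1 : 'M_(rk G 1, rk F 1)) (g : 'I_c -> 'M_(rk G 1, rk F 0)),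
  dif G 0 *m B - B1 *m dt 0 = \sum_j fseq X j *: g j.
Proof.
have [B1 B1E] : exists B1, dif G 0 *m B ~[c] B1 *m dt 0.
  apply: (kernel_mod_lift (aug_lift_kernel L)) => i; rewrite row_mul -BE.
  by rewrite -[dif G 0]mul1mx aug_dif.
exists B1; apply: mx_span; rewrite map_mxB.
by apply/eqP; rewrite subr_eq0; apply/eqP/quo_eqmodI.
Qed.

Lemma cocycle_A (y : 'cV_(rk G 0)) : (dif G 0)^r *m y = 0 -> (dt 0)^r *m (A^r *m y) = 0.
Proof.
by move=> Zy; have [A1 E] := dt_A; rewrite mulmxA -map_mxM E map_mxM -mulmxA Zy mulmx0.
Qed.

Lemma cocycle_B (z : 'cV_(rk F 0)) : (dt 0)^r *m z = 0 -> (dif G 0)^r *m (B^r *m z) = 0.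
Proof.
move=> Zz; have [B1 [g E]] := dif_B; rewrite mulmxA -map_mxM.
rewrite -[dif G 0 *m B](subrK (B1 *m dt 0)) E map_mxD map_mxM mulmxDl -mulmxA Zz mulmx0.
rewrite addr0 map_mx_sum big1 ?mul0mx // => j _.
by rewrite map_mxZ ci_fseq_max scale0r.
Qed.

(** Both d1 A1 and sum t_j A sigma_j have the product sum f_j t_j A with the first differential of
    [G]: one because d1 d0 = sum f_j t_j, the other because sigma_j is a homotopy. They differ by a
    multiple of the next differential, which [W] annihilates. *)
Lemma ext1_relation (W : 'cV_(rk G 1)) : (dif G 1)^r *m W = 0 ->
  exists y, \sum_j (t j 0)^r *m (A^r *m ((htp sg j 0)^r *m W)) = (dt 1)^r *m y.
Proof.
move=> W0; have [A1 A1E] := dt_A.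
have [N NE] : exists N, dt 1 *m A1 - \sum_j t j 0 *m A *m htp sg j 0 = N *m dif G 1.
  apply: dif_lift; rewrite mulmxBl -mulmxA -A1E mulmxA lift_tP !mulmx_suml -sumrB.
  rewrite big1 // => j _; rewrite -[t j 0 *m A *m _ *m _]mulmxA (htpP sg j).1.
  by rewrite mul_mx_scalar -scalemxAl subrr.
exists (A1^r *m W); apply/eqP; rewrite eq_sym -subr_eq0 mulmxA -map_mxM.
have -> : \sum_j (t j 0)^r *m (A^r *m ((htp sg j 0)^r *m W)) =
    (\sum_j t j 0 *m A *m htp sg j 0)^r *m W.
  by rewrite map_mx_sum mulmx_suml; apply: eq_bigr => j _; rewrite !map_mxM !mulmxA.
by rewrite -mulmxBl -map_mxB NE map_mxM -mulmxA W0 mulmx0.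
Qed.

Lemma mx_syzygy_res m n (D : 'I_c -> 'M[S]_(m, n)) :
  \sum_i fseq X i *: D i = 0 -> forall i, (D i)^r = 0.
Proof. by move=> /mx_syzygy D0 i; rewrite -map_res D0 map_mx0. Qed.

Lemma ext2_relation (z : 'I_c -> 'cV_(rk F 0)) y :
    (forall j, (dt 0)^r *m z j = 0) -> \sum_j (t j 0)^r *m z j = (dt 1)^r *m y ->
  exists W, (dif G 1)^r *m W = 0 /\ forall j, (htp sg j 0)^r *m W = B^r *m z j.
Proof.
move=> Zz zy; have [B1 [g gE]] := dif_B.
have dE : dif G 0 *m B = B1 *m dt 0 + \sum_j fseq X j *: g j by rewrite -gE addrC subrK.
have lift_kernel l (Y : 'M_(l, rk F 1)) : Y *m dt 0 ~[c] 0 ->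
    exists N h, Y = N *m dt 1 + \sum_j fseq X j *: h j.
  move=> /((lift_resolves L).2 0%N l Y)[N NE]; exists N.
  have [h hE] : exists h : 'I_c -> 'M_(l, rk F 1), Y - N *m dt 1 = \sum_j fseq X j *: h j.
    by apply: mx_span; rewrite map_mxB; apply/eqP; rewrite subr_eq0; apply/eqP/quo_eqmodI.
  by exists h; rewrite -hE addrC subrK.
have in_I l n (h : 'I_c -> 'M[S]_(l, n)) : \sum_j fseq X j *: h j ~[c] 0.
  apply/eqmodI0; exists (onat 0 h); apply: eq_bigr => j _.
  by rewrite onatE fnatE.
have kerB l (Y : 'M_(l, rk G 1)) : Y *m dif G 0 *m B ~[c] 0 ->
    exists N h, Y *m B1 = N *m dt 1 + \sum_j fseq X j *: h j.
  move=> YB; apply: lift_kernel.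
  have -> : Y *m B1 *m dt 0 = Y *m dif G 0 *m B - \sum_j fseq X j *: (Y *m g j).
    rewrite -[Y *m dif G 0 *m B]mulmxA dE mulmxDr mulmx_sumr mulmxA.
    under [X in _ = _ + X - _]eq_bigr do rewrite -scalemxAr.
    by rewrite addrK.
  by rewrite YB in_I subrr; reflexivity.
(* Expanding Y d B through [B1] gives a second expression in the f_j; by regularity the coefficients
   agree modulo the maximal ideal. *)
have mod_m l (Y : 'M_(l, rk G 1)) N h (Q : 'I_c -> 'M_(l, rk F 0)) :
    Y *m dif G 0 *m B = \sum_j fseq X j *: Q j ->
    Y *m B1 = N *m dt 1 + \sum_j fseq X j *: h j ->
  forall j, (Q j)^r = (N *m t j 0 + h j *m dt 0 + Y *m g j)^r.
  move=> YQ YB j; apply/eqP; rewrite -subr_eq0 -map_mxB; apply/eqP; move: j.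
  apply: (mx_syzygy_res (D := fun j => Q j - (N *m t j 0 + h j *m dt 0 + Y *m g j))).
  under eq_bigr do rewrite scalerBr !scalerDr.
  rewrite sumrB !big_split /= -YQ -mulmxA dE mulmxDr mulmxA YB mulmxDl -mulmxA lift_tP.
  rewrite !mulmx_sumr mulmx_suml.
  under [X in X + _ + _ - _]eq_bigr do rewrite -scalemxAr.
  under [X in _ + X + _ - _]eq_bigr do rewrite -scalemxAl.
  under [X in _ + _ + X - _]eq_bigr do rewrite -scalemxAr.
  by rewrite subrr.
(* The witness is designed so that Y W = sum Q_j z_j whenever Y d B = sum f_j Q_j. Taking Y to be
   the next differential, with Q = 0, gives the cocycle condition; taking Y = sigma_j, with [B] in
   position j, gives the required values. *)
exists (B1^r *m y + \sum_j (g j)^r *m z j).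
have tail l (Y : 'M_(l, rk G 1)) N h (Q : 'I_c -> 'M_(l, rk F 0)) :
    Y *m dif G 0 *m B = \sum_j fseq X j *: Q j ->
    Y *m B1 = N *m dt 1 + \sum_j fseq X j *: h j ->
  Y^r *m (B1^r *m y + \sum_j (g j)^r *m z j) = \sum_j (Q j)^r *m z j.
  move=> YQ YB; rewrite mulmxDr mulmxA -map_mxM YB map_mxD map_mx_sum.
  rewrite [X in (_ + X) *m y](_ : _ = 0) ?addr0; last first.
    by apply: big1 => j _; rewrite map_mxZ ci_fseq_max scale0r.
  rewrite map_mxM -mulmxA -zy !mulmx_sumr -big_split; apply: eq_bigr => j _.
  rewrite (mod_m _ _ _ _ _ YQ YB) !map_mxD !map_mxM !mulmxDl -!mulmxA Zz mulmx0.
  by rewrite addr0.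
split=> [|j].
  have d0 : dif G 1 *m dif G 0 *m B = \sum_j fseq X j *: (0 : 'M_(rk G 2, rk F 0)).
    by rewrite dif_dif mul0mx big1 // => j _; rewrite scaler0.
  have [|N [h NE]] := @kerB _ (dif G 1); first by rewrite d0.
  by rewrite (tail _ _ _ _ _ d0 NE) big1 // => j _; rewrite map_mx0 mul0mx.
pose Q l : 'M_(rk G 0, rk F 0) := if l == j then B else 0.
have sB : htp sg j 0 *m dif G 0 *m B = \sum_l fseq X l *: Q l.
  rewrite (htpP sg j).1 mul_scalar_mx (bigD1 j) //= /Q eqxx big1 ?addr0 //.
  by move=> l /negPf->; rewrite scaler0.
have [|N [h NE]] := @kerB _ (htp sg j 0); first by rewrite sB.
rewrite (tail _ _ _ _ _ sB NE) (bigD1 j) //= /Q eqxx big1 ?addr0 // => l /negPf->.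
by rewrite map_mx0 mul0mx.
Qed.

End LowDegree.

(** * Transfer to the even Ext module *)

Section Assembly.
Variables (S : comUnitRingType) (k : fieldType) (R : comNzRingType) (c : nat).
Variables (X : ci_setting S k R c) (M : lmodType R).
Variables (F : free_resolution (idfun : {rmorphism R -> R}) M) (L : ci_lift X F).
Variables (G : free_resolution (quo X) M) (sg : homotopies G).
Variables (A : 'M[S]_(rk F 0, rk G 0)) (B : 'M[S]_(rk G 0, rk F 0)).
Hypotheses (AE : forall x, aug_lift X x = aug G (x *m A))
           (BE : forall y, aug G y = aug_lift X (y *m B)).
Local Notation "A ^r" := (map_mx (res X) A) (at level 2, format "A ^r").
Notation C := (lift_lcplx L).
Notation N := (ext_even_gr L).

(** Since [A] lifts the identity of [M] from [F] to [G], precomposition with it turns a functional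
    on Tor_0 into a 0-cocycle for [F]. *)
Definition hom_ext (v : extS G 0) : gr_deg N 0 := ext_cls X F 0 (A^r *m ext_vec v).

Fact hom_ext_is_linear : linear hom_ext.
Proof. by move=> a v w; rewrite /hom_ext ext_vecP mulmxDr -scalemxAr /ext_cls linearP. Qed.
HB.instance Definition _ :=
  GRing.isLinear.Build k (extS G 0) (gr_deg N 0) *:%R hom_ext hom_ext_is_linear.

Definition mu_comp (j : 'I_c) (w : extS G 1) : extS G 0 := (w \o mu sg j)%VF.

Fact mu_comp_is_linear j : linear (mu_comp j).
Proof. by move=> a v w; rewrite /mu_comp comp_lfunDl comp_lfunZl. Qed.
HB.instance Definition _ j :=
  GRing.isLinear.Build k (extS G 1) (extS G 0) *:%R (mu_comp j) (mu_comp_is_linear j).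

Lemma hom_ext_cocycle v : (A^r *m ext_vec v : 'cV_(rk F 0)) \in ext_cocycles X F 0.
Proof. by rewrite (mem_cocycles L) (cocycle_A L AE) // ext_vec_cocycle. Qed.

Lemma hom_ext_inj v : hom_ext v = 0 -> v = 0.
Proof.
move=> /(cls_eq0 _ (hom_ext_cocycle v)).1; rewrite memv0 => /eqP v0.
apply: ext_vec_inj; rewrite -[LHS](compBA AE BE) ?ext_vec_cocycle // v0 mulmx0.
by apply/colP => l; rewrite !mxE lfunE.
Qed.

Lemma hom_ext_surj x : exists v, hom_ext v = x.
Proof.
have := rep_mem (x : extR X F 0); rewrite (mem_cocycles L) => /eqP Zx.
have [v vE] := ext_of_vec (cocycle_B BE Zx).
exists v; rewrite -[RHS](repK (x : extR X F 0)) /hom_ext /ext_cls; congr cls.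
rewrite -[RHS](compAB AE BE Zx); congr (_ *m _); apply/colP => l.
by rewrite mxE vE ?memvf // -rowE mxE.
Qed.

Lemma hom_ext_same v : same_hom v (hom_ext v : extR X F 0).
Proof.
(* The homomorphism evaluates [v] on a chosen preimage; two preimages differ by a boundary, on which
   [v] vanishes. *)
pose g (z : M) : k^o := v (tor_cls G 0 (sval (cid (aug_surj G z)))^r).
have gE y : g (aug G y) = v (tor_cls G 0 y^r).
  have /eqP := svalP (cid (aug_surj G (aug G y))); rewrite /g; move: (sval _) => y' y'E.
  have /aug_exact[W WE] : aug G (y' - y) = 0.
    by rewrite (quo_linearB _ _ (@aug_quo_linear _ _ _ _ _ _ G)); apply/eqP; rewrite subr_eq0.
  rewrite !ext_vecE -[y'](subrK y) WE map_mxD map_mxM mulmxDl -mulmxA.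
  by rewrite ext_vec_cocycle mulmx0 add0r.
have g_lin : linear_for (resR X \; *%R) g.
  move=> a x y; have [a' <-] := ci_quo_surj X a.
  have [x' <-] := aug_surj G x; have [y' <-] := aug_surj G y.
  rewrite -(@aug_quo_linear _ _ _ _ _ _ G) !gE map_mxD map_mxZ /tor_cls !linearP /=.
  by rewrite ci_resR_quo.
pose phi : {linear M -> k^o | resR X \; *%R} :=
  HB.pack g (GRing.isLinear.Build R M k^o (resR X \; *%R) g g_lin).
exists phi; split=> [|]; first exact: gE.
rewrite /hom_ext; congr ext_cls; apply/colP => i; rewrite [RHS]mxE /=.
have -> : aug F (delta_mx 0 i) = aug G (delta_mx 0 i *m A).
  by rewrite -AE /aug_lift map_delta_mx.
by rewrite gE ext_vecE map_mxM map_delta_mx -mulmxA -rowE [RHS]mxE.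
Qed.

Lemma even_chi j (i : 'I_c) (w : 'cV_(rk F j.*2)) : cocycle (res X) (C := C) w ->
  gr_chi N i j (ext_cls X F j.*2 w) = ext_cls X F j.*2.+2 ((lop C i j.*2)^r *m w).
Proof.
by move=> Zw; rewrite /= ext_chi_cls ?onatE // (mem_cocycles L); apply/eqP.
Qed.

Lemma ext_cls_coboundary n (y : 'cV_(rk F n)) : ext_cls X F n.+1 ((ld C n)^r *m y) = 0.
Proof.
apply/cls_eq0; last exact: mem_cobounds.
rewrite (mem_cocycles L) mulmxA.
by rewrite (ld_ld_res (fnat_res X) _ (lift_resolves L)) mul0mx.
Qed.

Lemma ext_cls_eq0 n (z : 'cV_(rk F n.+1)) : z \in ext_cocycles X F n.+1 ->
  ext_cls X F n.+1 z = 0 -> exists y, z = (ld C n)^r *m y.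
Proof.
move=> Zz /(cls_eq0 _ Zz).1/memv_imgP[y _ ->]; exists y.
by rewrite lfunE /= (ext_difE L).
Qed.

Lemma even_gen : gen_step (res X) c C -> forall j (x : gr_deg N j.+1),
  exists w : 'I_c -> gr_deg N j, x = \sum_i gr_chi N i j (w i).
Proof.
move=> genC j x; have := rep_mem (x : extR X F j.*2.+2).
rewrite (mem_cocycles L) => /eqP Zx.
have [w [y [Zw wE]]] := genC j.*2 _ Zx.
exists (fun i => ext_cls X F j.*2 (w i)).
rewrite -[x in LHS](repK (x : extR X F j.*2.+2)) wE linearD linear_sum.
rewrite [X in _ + X](ext_cls_coboundary y) addr0.
by apply: eq_bigr => i _; rewrite even_chi.
Qed.

Lemma even_rel : rel_step (res X) c C -> forall j (q : 'I_c) (x : 'I_c -> gr_deg N j.+1),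
  \sum_(i < c | (q <= i)%N) gr_chi N i j.+1 (x i) = 0 ->
  exists w : 'I_c -> gr_deg N j, x q = \sum_(i < c | (q < i)%N) gr_chi N i j (w i).
Proof.
move=> relC j q x x0.
pose z i := rep (x i : extR X F j.*2.+2).
have Zz i : cocycle (res X) (C := C) (z i).
  by have := rep_mem (x i : extR X F j.*2.+2); rewrite (mem_cocycles L) => /eqP.
have [||w [y [Zw wE]]] := relC j.*2 q (onat 0 z) (ltn_ord q).
- by move=> l; rewrite /onat; case: insub => [i|] /=; [exact: Zz | rewrite /cocycle mulmx0].
- rewrite big_geq_mkord /=.
  have : ext_cls X F j.*2.+4 (\sum_(i < c | (q <= i)%N) (lop C i j.*2.+2)^r *m z i) = 0.
    rewrite -x0 /ext_cls linear_sum; apply: eq_bigr => i _.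
    rewrite -[x i](repK (x i : extR X F j.*2.+2)).
    by rewrite -/(ext_cls X F j.*2.+2 _) (even_chi (j := j.+1)) //; exact: (Zz i).
  move=> /ext_cls_eq0[|y yE].
    apply: rpred_sum => i _ /=; rewrite onatE; apply: chi_cocycles.
    by rewrite (mem_cocycles L); apply/eqP/Zz.
  by exists y; rewrite -yE; apply: eq_bigr => i _ /=; rewrite !onatE.
exists (fun i => ext_cls X F j.*2 (w i)).
rewrite -[x q in LHS](repK (x q : extR X F j.*2.+2)) -/(z q).
move: wE; rewrite onatE => ->; rewrite linearD big_geq_mkord linear_sum.
rewrite [X in _ + X](ext_cls_coboundary y) addr0.
by apply: eq_bigr => i _; rewrite even_chi.
Qed.

Lemma mu_relation w : \sum_i gr_chi N i 0 (hom_ext (mu_comp i w)) = 0.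
Proof.
have [y yE] := ext1_relation L sg AE (ext_vec_cocycle w).
transitivity (ext_cls X F 2 ((ld C 1)^r *m y)); last exact: ext_cls_coboundary.
rewrite -yE /ext_cls linear_sum; apply: eq_bigr => i _.
have Zi := hom_ext_cocycle (mu_comp i w).
rewrite /hom_ext (even_chi (j := 0)) ?onatE; last by move: Zi; rewrite (mem_cocycles L) => /eqP.
by rewrite /mu_comp (ext_vec_mu sg i (fun z _ => ext_vecE w z)) /= onatE.
Qed.

Lemma relation_mu (v : 'I_c -> extS G 0) : \sum_i gr_chi N i 0 (hom_ext (v i)) = 0 ->
  exists w, forall i, v i = mu_comp i w.
Proof.
move=> v0; pose z i := A^r *m ext_vec (v i).
have Zz i : (lift_dif L 0)^r *m z i = 0.
  by have := hom_ext_cocycle (v i); rewrite (mem_cocycles L) => /eqP.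
have : ext_cls X F 2 (\sum_i (lift_t L i 0)^r *m z i) = 0.
  rewrite -v0 /ext_cls linear_sum; apply: eq_bigr => i _.
  by rewrite /hom_ext (even_chi (j := 0)) /= ?onatE //; apply: Zz.
move=> /ext_cls_eq0[|y yE].
  apply: rpred_sum => i _; apply: chi_cocycles.
  by rewrite (mem_cocycles L) Zz.
have [W [W0 WE]] := ext2_relation sg BE Zz yE.
have [w wE] := ext_of_vec W0.
exists w => i; apply: ext_vec_inj.
by rewrite (ext_vec_mu sg i wE) WE (compBA AE BE) // ext_vec_cocycle.
Qed.

End Assembly.

Theorem corollary9p5 (S : comUnitRingType) (k : fieldType) (R : comNzRingType)
    (c : nat) (X : ci_setting S k R c)
    (H : hmf X) (Hmin : hmf_minimal H)
    (M : lmodType R) (q : {linear 'rV[R]_(hmf_n0 H) -> M})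
    (Mcoker : is_coker (map_mx (quo X) (hmf_d H)) q)
    (G : free_resolution (quo X) M) (sg : homotopies G)
    (F : free_resolution (idfun : {rmorphism R -> R}) M) (L : ci_lift X F) :
  exists (tau : {linear tens c (extS G 1) -> tens c (extS G 0)})
         (eps : {linear tens c (extS G 0) -> ext_even L}),
    [/\ forall w : extS G 1, tau (pure w 1) = mu_dual sg w,
        forall v : extS G 0, exists x : extR X F 0,
          same_hom v x /\ eps (pure v 1) = ext_even_in0 L x,
        forall z : ext_even L, exists u, eps u = z &
        forall u, eps u = 0 <-> exists w, u = tau w].
Proof.
have Flin := @aug_lift_quo_linear _ _ _ _ X _ F.
have Fsurj := @aug_lift_surj _ _ _ _ X _ F.
have Glin := @aug_quo_linear _ _ _ _ _ _ G.
have [A AE] := quo_linear_lift Flin Glin (aug_surj G).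
have [B BE] := quo_linear_lift Glin Flin Fsurj.
have ret : retract (fnat X) c (lift_dif L 0) (hmf_d H).
  apply: (presentation_retract Flin (coker_quo_linear X q) Fsurj).
  - by move=> z; apply: coker_surj Mcoker.
  - exact: aug_lift_kernel.
  - exact: coker_kernel.
have basis1 n (U : 'rV[S]_n -> Prop) : (forall x, U x) -> is_basis U (1%:M : 'M_n).
  move=> UT; split=> [x|a a']; last by rewrite !mulmx1.
  by split=> // _; exists x; rewrite mulmx1.
(* At stage c both filtrations are everything, so identity matrices serve as bases and [hmf_d H]
   itself is the presentation. *)
have [genC relC] : gen_step (res X) c (lift_lcplx L) /\ rel_step (res X) c (lift_lcplx L).
  apply: (hmf_steps Hmin (leqnn c) (b0 := 1%:M) (b1 := 1%:M) (E := hmf_d H)) => //.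
  - by apply: basis1; case: (hmf_filt0 H).
  - by apply: basis1; case: (hmf_filt1 H).
  - by rewrite mulmx1 mul1mx.
  - exact: lift_resolves.
have inj := @hom_ext_inj _ _ _ _ _ _ _ L _ _ _ AE BE.
have surj := @hom_ext_surj _ _ _ _ _ _ _ L _ _ _ AE BE.
have mu_rel := @mu_relation _ _ _ _ _ _ _ L _ sg _ AE.
have rel_mu := @relation_mu _ _ _ _ _ _ _ L _ sg _ _ AE BE.
have [tauP epsP eps_onto ker] := linear_presentation (N := ext_even_gr L)
  (e := hom_ext L A) (rho := mu_comp sg) inj surj
  (even_gen genC) mu_rel rel_mu (even_rel relC).
exists (tau (fun j => mu_comp sg j)), (eps (N := ext_even_gr L) (hom_ext L A)); split=> //.
by move=> v; exists (hom_ext L A v); split; [exact: hom_ext_same AE v | exact: epsP].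
Qed.
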